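(* Let $k$ be an algebraically closed field of characteristic zero. For $j\in\{1,2\}$ let $n_j>1$, $m_j>1$ be integers, let $$P_{1}(X,Y)=Y^{m_{1}}+f_{m_{1}-2}(X)Y^{m_{1}-2}+\cdots+f_{0}(X),\qquad P_{2}(X,Y)=Y^{m_{2}}+g_{m_{2}-2}(X)Y^{m_{2}-2}+\cdots+g_{0}(X)$$ with $f_i,g_i\in k[X]$, and let $B_j=k[X,Y,Z]/\langle X^{n_j}Z-P_j(X,Y)\rangle=k[x_j,y_j,z_j]$, where $x_j,y_j,z_j$ are the images of $X,Y,Z$. Then $B_1$ and $B_2$ are isomorphic as $k$-algebras if and only if $n_1=n_2=:n$, $m_1=m_2=:m$, and there exist $\lambda,\mu\in k^{*}$ such that $f_{m-i}(\lambda x)\equiv\mu^{i}g_{m-i}(x)\pmod{x^{n}}$ for every $i\in\{2,\ldots,m\}$. In addition, every $k$-algebra isomorphism $\Psi:B_1\to B_2$ takes the form $$\Psi(x_{1},y_{1},z_{1})=\left(\lambda x_{2},\ \mu y_{2}+x_{2}^{n}a(x_{2}),\ \frac{\mu^{m}}{\lambda^{n}}z_{2}+\frac{P_{1}(\lambda x_{2},\ \mu y_{2}+x_{2}^{n}a(x_{2}))-\mu^{m}P_{2}(x_{2},y_{2})}{\lambda^{n}x_{2}^{n}}\right),$$ where $a(x)\in k[x]$ and $\lambda,\mu\in k^{*}$ satisfy $f_{m-i}(\lambda x)\equiv\mu^{i}g_{m-i}(x)\pmod{x^{n}}$ for all $i\in\{2,\ldots,m\}$.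
   Context: The notation $\Psi(x_1,y_1,z_1)=(b_1,b_2,b_3)$ means $\Psi(x_1)=b_1$, $\Psi(y_1)=b_2$, $\Psi(z_1)=b_3$. Congruences are in the polynomial ring $k[x]$. *)

(* Defs.v *)
From HB Require Import structures.
From mathcomp Require Import all_boot all_order all_algebra.
From mathcomp Require Import ring_quotient boolp.
From mathcomp Require Import mpoly.

Set Implicit Arguments.
Unset Strict Implicit.
Unset Printing Implicit Defensive.

Import GRing.Theory.
Local Open Scope ring_scope.
Local Open Scope quotient_scope.

(* Substitution of elements of a commutative k-algebra for the variables. *)
Definition alg_eval (k : fieldType) (A : comAlgType k) (d : nat)
    (v : d.-tuple A) (p : {mpoly k[d]}) : A :=
  mmap (GRing.in_alg A) (tnth v) p.

Section AlgEval.
Variables (k : fieldType) (A B : comAlgType k) (d : nat).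

HB.instance Definition _ (v : d.-tuple A) :=
  GRing.RMorphism.copy (alg_eval v) (mmap (GRing.in_alg A) (tnth v)).

Fact alg_eval_is_scalable (v : d.-tuple A) : scalable (alg_eval v).
Proof. by move=> a p; rewrite /alg_eval mmapZ mulr_algl. Qed.

HB.instance Definition _ (v : d.-tuple A) :=
  GRing.isScalable.Build k {mpoly k[d]} A *:%R (alg_eval v)
    (alg_eval_is_scalable v).

Lemma alg_evalX (v : d.-tuple A) i : alg_eval v 'X_i = tnth v i.
Proof. by rewrite /alg_eval mmapX mmap1U. Qed.

Lemma alg_eval_comp (h : {lrmorphism A -> B}) (v : d.-tuple A) p :
  h (alg_eval v p) = alg_eval (map_tuple h v) p.
Proof.
rewrite /alg_eval /mmap raddf_sum /=; apply: eq_bigr => m _.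
rewrite !mulr_algl linearZ rmorph_prod; congr (_ *: _).
by apply: eq_bigr => i _; rewrite rmorphXn tnth_map.
Qed.

End AlgEval.

Section Danielewski.
Variable k : fieldType.

Definition X2 : {mpoly k[2]} := 'X_(@Ordinal 2 0 isT).
Definition Y2 : {mpoly k[2]} := 'X_(@Ordinal 2 1 isT).
Definition X3 : {mpoly k[3]} := 'X_(@Ordinal 3 0 isT).
Definition Y3 : {mpoly k[3]} := 'X_(@Ordinal 3 1 isT).
Definition Z3 : {mpoly k[3]} := 'X_(@Ordinal 3 2 isT).

(* Y^m + f_{m-2}(X) Y^(m-2) + ... + f_0(X); only f 0, ..., f (m-2) matter. *)
Definition Ppoly (m : nat) (f : nat -> {poly k}) : {mpoly k[2]} :=
  Y2 ^+ m + \sum_(i < m.-1) horner_alg X2 (f i) * Y2 ^+ i.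

Section Quotient.
Variables (n : nat) (P : {mpoly k[2]}).

Definition rel_poly : {mpoly k[3]} :=
  X3 ^+ n * Z3 - alg_eval [tuple X3; Y3] P.

(* The principal ideal <X^n Z - P(X,Y)>; `[< >] makes membership boolean, as
   {ideal_quot _} requires. *)
Definition rel_ideal : {pred {mpoly k[3]}} :=
  fun p => `[< exists q, p = q * rel_poly >].

Lemma rel_idealP : idealr_closed rel_ideal.
Proof.
split.
- by apply/asboolP; exists 0; rewrite mul0r.
- apply/negP => /asboolP [q].
  pose c : k^o := alg_eval [tuple 1; 0] P.
  pose h : {mpoly k[3]} -> k^o := alg_eval [tuple 1; 0; c].
  move/(congr1 h); rewrite /h rmorph1 rmorphM rmorphB rmorphM rmorphXn /=.
  rewrite !alg_evalX alg_eval_comp !(tnth_nth 0) /= expr1n mul1r.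
  suff -> : map_tuple (alg_eval [tuple 1; 0; c]) [tuple X3; Y3]
      = [tuple 1; 0].
    by rewrite subrr mulr0 => /eqP; rewrite oner_eq0.
  by apply: val_inj => /=; rewrite !alg_evalX.
- move=> a u v /asboolP [p ->] /asboolP [q ->]; apply/asboolP.
  by exists (a * p + q); rewrite mulrDl mulrA.
Qed.

HB.instance Definition _ :=
  isIdealr.Build {mpoly k[3]} rel_ideal rel_idealP.

Definition Balg : Type := {ideal_quot rel_ideal}.

HB.instance Definition _ := GRing.ComNzRing.on Balg.

Definition toB : {mpoly k[3]} -> Balg := \pi_{ideal_quot rel_ideal}.

Fact toB_is_zmod_morphism : zmod_morphism toB.
Proof. by move=> p q; rewrite /toB rmorphB. Qed.
Fact toB_is_monoid_morphism : monoid_morphism toB.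
Proof. by split=> [|p q]; rewrite /toB (rmorph1, rmorphM). Qed.
HB.instance Definition _ :=
  GRing.isZmodMorphism.Build {mpoly k[3]} Balg toB toB_is_zmod_morphism.
HB.instance Definition _ :=
  GRing.isMonoidMorphism.Build {mpoly k[3]} Balg toB toB_is_monoid_morphism.

Definition scaleB (a : k) (b : Balg) : Balg := toB a%:MP * b.

Fact scaleBA a b x : scaleB a (scaleB b x) = scaleB (a * b) x.
Proof. by rewrite /scaleB mulrA -rmorphM mpolyCM. Qed.
Fact scaleB1 : left_id 1 scaleB.
Proof. by move=> x; rewrite /scaleB mpolyC1 rmorph1 mul1r. Qed.
Fact scaleBDr : right_distributive scaleB +%R.
Proof. by move=> a x y; rewrite /scaleB mulrDr. Qed.
Fact scaleBDl x : {morph scaleB^~ x : a b / a + b}.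
Proof. by move=> a b; rewrite /scaleB mpolyCD rmorphD mulrDl. Qed.
HB.instance Definition _ :=
  GRing.Zmodule_isLmodule.Build k Balg scaleBA scaleB1 scaleBDr scaleBDl.

Fact scaleBAl (a : k) (x y : Balg) : a *: (x * y) = a *: x * y.
Proof. exact: mulrA. Qed.
HB.instance Definition _ := GRing.Lmodule_isLalgebra.Build k Balg scaleBAl.
Fact scaleBAr (a : k) (x y : Balg) : a *: (x * y) = x * (a *: y).
Proof. exact: mulrCA. Qed.
HB.instance Definition _ := GRing.Lalgebra_isAlgebra.Build k Balg scaleBAr.

Fact toB_is_scalable : scalable toB.
Proof. by move=> a p; rewrite -mul_mpolyC rmorphM. Qed.
HB.instance Definition _ :=
  GRing.isScalable.Build k {mpoly k[3]} Balg *:%R toB toB_is_scalable.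

Lemma toB_eq0 p : (toB p == 0) = (p \in rel_ideal).
Proof. by rewrite -[0](rmorph0 toB) /toB -Quotient.idealrBE subr0. Qed.

Lemma toB_surj b : exists p, toB p = b.
Proof. by exists (repr b); rewrite /toB reprK. Qed.

Definition xB : Balg := toB X3.
Definition yB : Balg := toB Y3.
Definition zB : Balg := toB Z3.

End Quotient.

Definition coef_cong (n m : nat) (f g : nat -> {poly k}) (lambda mu : k) :=
  forall i : nat, (2 <= i <= m)%N ->
    'X^n %| f (m - i)%N \Po (lambda *: 'X) - mu ^+ i *: g (m - i)%N.

End Danielewski.

Arguments X2 {k}.
Arguments Y2 {k}.
Arguments X3 {k}.
Arguments Y3 {k}.
Arguments Z3 {k}.

(* Main.v *)
(* Inside [k[x, 1/x, y]] every element of [B = k[x, y, z] / (x^n z - P)] has a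
   leading monomial (for the order where [y] dominates), and these monomials
   fill the cone of the [x^i y^j] with [i >= - n (j %/ m)].  The leading form of
   a locally nilpotent derivation [D] of [B] multiplies [x^i y^j] by a linear form
   in [(i, j)] and shifts it by a fixed vector; since it has to preserve the cone
   and to kill each monomial after finitely many steps, [n, m > 1] forces
   [D x = 0] and then [D y] is a multiple of [x^n].
   Transporting the derivation [x^n d/dy + P_y d/dz] through an isomorphism
   therefore shows that [Psi] maps [k[x1]] onto [k[x2]] and that [Psi y1] has
   degree 1 in [y2]; comparing the values of the derivation at [y1] gives
   [Psi x1 = lambda x2] and [n1 = n2].  Finally [x1^n z1 = P1] says that
   [P1 (lambda x, mu y + v)] lies in the ideal [(x^n, P2)] of [k[x, y]], and the
   congruences are read off the coefficients of the powers of [y]. *)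

Require Import Defs.
From HB Require Import structures.
From mathcomp Require Import all_boot all_order all_algebra.
From mathcomp Require Import ring_quotient boolp.
From mathcomp Require Import mpoly.
From mathcomp Require Import zify ring.

Set Implicit Arguments.
Unset Strict Implicit.
Unset Printing Implicit Defensive.

Import GRing.Theory.
Local Open Scope ring_scope.

(** * Bivariate polynomials and derivations *)

Section BivariateEvaluation.
Variables (k : fieldType) (A : comAlgType k).
Implicit Types (a b : A) (p : {poly k}) (U : {poly {poly k}}).

Fact ev2_key : unit. Proof. exact: tt. Qed.

(* Locked, so that unification does not unfold it. *)
Definition ev2 a b : {poly {poly k}} -> A :=
  locked_with ev2_key (horner_eval b \o map_poly (horner_alg a)).

Lemma ev2E a b U : ev2 a b U = (map_poly (horner_alg a) U).[b].
Proof. by rewrite /ev2 unlock. Qed.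

Fact ev2_is_zmod_morphism a b : zmod_morphism (ev2 a b).
Proof. by move=> U V; rewrite !ev2E rmorphB hornerD hornerN. Qed.
Fact ev2_is_monoid_morphism a b : monoid_morphism (ev2 a b).
Proof.
split=> [|U V]; rewrite !ev2E ?rmorph1 ?hornerC //.
by rewrite rmorphM hornerM.
Qed.
HB.instance Definition _ a b := GRing.isZmodMorphism.Build {poly {poly k}} A
  (ev2 a b) (ev2_is_zmod_morphism a b).
HB.instance Definition _ a b := GRing.isMonoidMorphism.Build {poly {poly k}} A
  (ev2 a b) (ev2_is_monoid_morphism a b).

Lemma ev2C a b p : ev2 a b p%:P = horner_alg a p.
Proof. by rewrite ev2E map_polyC hornerC. Qed.

Lemma ev2X a b : ev2 a b 'X = b.
Proof. by rewrite ev2E map_polyX hornerX. Qed.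

(* Direct instances of the [rmorph] lemmas, whose unification is very slow for
   the source ring [{poly {poly k}}]. *)
Lemma ev2_0 a b : ev2 a b 0 = 0. Proof. by rewrite ev2E rmorph0 horner0. Qed.
Lemma ev2D a b U V : ev2 a b (U + V) = ev2 a b U + ev2 a b V.
Proof. by rewrite !ev2E rmorphD hornerD. Qed.
Lemma ev2B a b U V : ev2 a b (U - V) = ev2 a b U - ev2 a b V.
Proof. by rewrite !ev2E rmorphB hornerD hornerN. Qed.
Lemma ev2M a b U V : ev2 a b (U * V) = ev2 a b U * ev2 a b V.
Proof. by rewrite !ev2E rmorphM hornerM. Qed.
Lemma ev2Xn a b U l : ev2 a b (U ^+ l) = ev2 a b U ^+ l.
Proof. by rewrite !ev2E rmorphXn horner_exp. Qed.
Lemma ev2Mn a b U l : ev2 a b (U *+ l) = ev2 a b U *+ l.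
Proof. by rewrite !ev2E rmorphMn hornerMn. Qed.
Lemma ev2_sum a b (I : Type) (r : seq I) (F : I -> {poly {poly k}}) :
  ev2 a b (\sum_(i <- r) F i) = \sum_(i <- r) ev2 a b (F i).
Proof.
by rewrite ev2E rmorph_sum horner_sum; apply: eq_bigr => i _; rewrite ev2E.
Qed.

Lemma ev2_uniq (h : {rmorphism {poly {poly k}} -> A}) U :
  (forall c, h c%:P%:P = c%:A) -> h U = ev2 (h 'X%:P) (h 'X) U.
Proof.
move=> hC; elim/poly_ind: U => [|U p IH]; first by rewrite !rmorph0.
rewrite !rmorphD !rmorphM /= ev2X -IH ev2C; congr (_ + _).
elim/poly_ind: p => [|p c IHp]; first by rewrite !rmorph0.
by rewrite !(rmorphD, rmorphM) /= horner_algX horner_algC hC IHp.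
Qed.

End BivariateEvaluation.

Section Morphisms.
Variables (k : fieldType) (A A' : comAlgType k) (h : {lrmorphism A -> A'}).

Lemma rmorph_ev2 a b U : h (ev2 a b U) = ev2 (h a) (h b) U.
Proof.
rewrite -[LHS]/((h \o ev2 a b) U) ev2_uniq /= => [|c].
  by rewrite ev2C horner_algX ev2X.
by rewrite ev2C horner_algC linearZ rmorph1.
Qed.

Lemma rmorph_horner_alg a p : h (horner_alg a p) = horner_alg (h a) p.
Proof. by rewrite -(ev2C a 0) rmorph_ev2 ev2C. Qed.

End Morphisms.

Section Derivations.
Variables (k : fieldType) (A : comAlgType k) (D : {linear A -> A}).
Hypothesis leibniz : forall a b, D (a * b) = D a * b + a * D b.

Lemma der1 : D 1 = 0.
Proof.
by apply: (addrI (D 1)); rewrite addr0 -{3}[1]mulr1 leibniz mulr1 mul1r.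
Qed.

Lemma derX a n : D (a ^+ n) = a ^+ n.-1 * D a *+ n.
Proof.
elim: n => [|n IH]; first by rewrite expr0 der1 mulr0n.
rewrite exprS leibniz IH mulrnAr mulrA mulrS [D a * _]mulrC.
case: n {IH} => [|n]; first by rewrite !mulr0n.
by rewrite -exprS.
Qed.

Lemma der_horner_alg a p : D (horner_alg a p) = horner_alg a p^`() * D a.
Proof.
elim/poly_ind: p => [|p c IH]; first by rewrite deriv0 !rmorph0 raddf0 mul0r.
rewrite derivD derivM derivX derivC addr0 mulr1 !(rmorphD, rmorphM) /=.
rewrite horner_algX horner_algC linearD leibniz IH linearZ /=.
by rewrite der1 scaler0 addr0 mulrDl; ring.
Qed.

(** Chain rule: mapping [deriv] over the coefficients is d/dx, the outer derivative is d/dy. *)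
Lemma der_ev2 a b U :
  D (ev2 a b U) = ev2 a b (map_poly (@deriv k) U) * D a + ev2 a b U^`() * D b.
Proof.
elim/poly_ind: U => [|U p IH].
  by rewrite map_poly0 deriv0 !rmorph0 raddf0 !mul0r addr0.
have -> : map_poly (@deriv k) (U * 'X + p%:P)
    = map_poly (@deriv k) U * 'X + p^`()%:P.
  apply/polyP=> i; rewrite coef_map !coefD !coefMX !coefC /= derivD coef_map.
  by case: i => [|i] //=; rewrite ?deriv0.
rewrite derivD derivM derivX derivC addr0 mulr1 !(rmorphD, rmorphM) /=.
rewrite ev2X !ev2C linearD leibniz IH der_horner_alg; ring.
Qed.

End Derivations.

Section Char0.
Variable k : fieldType.
Hypothesis char0 : [pchar k] =i pred0.

Lemma char0_natr_eq0 n : (n%:R == 0 :> k) = (n == 0%N).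
Proof. by move/pcharf0P: char0 => ->. Qed.

Lemma char0_intr_eq0 (z : int) : (z%:~R == 0 :> k) = (z == 0).
Proof.
case: z => n; first exact: char0_natr_eq0.
by rewrite NegzE rmorphN /= oppr_eq0 char0_natr_eq0.
Qed.

Lemma char0_mulrn_eq0 (p : {poly k}) n : (p *+ n == 0) = (n == 0%N) || (p == 0).
Proof. by rewrite -scaler_nat scaler_eq0 char0_natr_eq0. Qed.

Lemma size_le_deriv (U : {poly {poly k}}) j :
  (size (U^`())%R <= j)%N -> (size U <= j.+1)%N.
Proof.
move=> sU; apply/leq_sizeP => -[|i] // ji.
have /eqP : U^`()`_i = 0 by move/leq_sizeP: sU; apply.
by rewrite coef_deriv char0_mulrn_eq0 /= => /eqP.
Qed.

End Char0.

(** * Lexicographic leading coefficients in k[x][y] *)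

Section LexLeading.
Variable k : fieldType.
Implicit Types U V : {poly {poly k}}.

Lemma coefM_top (R : comNzRingType) (p q : {poly R}) i j :
  (size p <= i.+1)%N -> (size q <= j.+1)%N -> (p * q)`_(i + j) = p`_i * q`_j.
Proof.
move=> /leq_sizeP sp /leq_sizeP sq; rewrite coefM.
have lt_i : (i < (i + j).+1)%N by rewrite ltnS leq_addr.
rewrite (bigD1 (Ordinal lt_i)) //= addKn big1 ?addr0 // => l /eqP nl.
have [lt_il|lt_li|eq_li] := ltngtP i l; first by rewrite sp // mul0r.
  by rewrite sq ?mulr0 //; lia.
by case: nl; apply: val_inj.
Qed.

(* [c], possibly zero, is the coefficient of [x^i y^j] in [U], and no larger
   monomial occurs in [U]. *)
Definition lex_coef U i j c :=
  [/\ (size U <= j.+1)%N, (size (U`_j)%R <= i.+1)%N & U`_j`_i = c].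

Lemma size_polyM_le (R : nzSemiRingType) (p q : {poly R}) i j :
  (size p <= i.+1)%N -> (size q <= j.+1)%N -> (size (p * q)%R <= (i + j).+1)%N.
Proof.
move=> sp sq; apply: leq_trans (size_polyMleq _ _) _.
by move: (size p) (size q) sp sq => a b; lia.
Qed.

Lemma lex_coefM U V i j c i' j' c' : lex_coef U i j c -> lex_coef V i' j' c' ->
  lex_coef (U * V) (i + i') (j + j') (c * c').
Proof.
move=> [sU sUj <-] [sV sVj <-]; split.
- exact: size_polyM_le.
- by rewrite coefM_top // size_polyM_le.
- by rewrite coefM_top // coefM_top.
Qed.

Lemma lex_coefD U V i j c c' : lex_coef U i j c -> lex_coef V i j c' ->
  lex_coef (U + V) i j (c + c').
Proof.
move=> [sU sUj <-] [sV sVj <-]; split; rewrite ?coefD //.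
  by rewrite (leq_trans (size_polyD _ _)) // geq_max sU.
by rewrite (leq_trans (size_polyD _ _)) // geq_max sUj.
Qed.

Lemma lex_coefMn U i j c l : lex_coef U i j c -> lex_coef (U *+ l) i j (c *+ l).
Proof.
move=> [sU sUj <-]; split; rewrite ?coefMn //.
  apply/leq_sizeP => r jr; rewrite coefMn.
  by move/leq_sizeP: sU => ->; rewrite ?mul0rn.
apply/leq_sizeP => r jr; rewrite coefMn.
by move/leq_sizeP: sUj => ->; rewrite ?mul0rn.
Qed.

(** The Euler operator x d/dx is diagonal on monomials, so the bounding monomial does not move, even
    when i = 0. *)
Lemma lex_coef_thetax U i j c : lex_coef U i j c ->
  lex_coef ('X%:P * map_poly (@deriv k) U) i j (c *+ i).
Proof.
move=> [sU sUj <-].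
have E l r : ('X%:P * map_poly (@deriv k) U)`_l`_r = U`_l`_r *+ r.
  rewrite coefCM coefXM coef_map /= coef_deriv.
  by case: r => [|r]; rewrite ?mulr0n.
split=> //; last by apply/leq_sizeP => r jr; rewrite E;
  move/leq_sizeP: sUj => ->; rewrite ?mul0rn.
apply/leq_sizeP => r jr; apply/polyP => l; rewrite E.
by move/leq_sizeP: sU => ->; rewrite ?coef0 ?mul0rn.
Qed.

Lemma lex_coef_thetay U i j c : lex_coef U i j c ->
  lex_coef ('X * U^`()) i j (c *+ j).
Proof.
move=> [sU sUj <-].
have E l : ('X * U^`())`_l = U`_l *+ l.
  by rewrite coefXM coef_deriv; case: l.
split; rewrite ?E ?coefMn //.
  apply/leq_sizeP => r jr; rewrite E.
  by move/leq_sizeP: sU => ->; rewrite ?mul0rn.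
apply/leq_sizeP => r jr; rewrite coefMn.
by move/leq_sizeP: sUj => ->; rewrite ?mul0rn.
Qed.

Lemma coef_max_size (R : nzSemiRingType) (p q : {poly R}) :
  (p != 0) || (q != 0) ->
  let i := (maxn (size p) (size q)).-1 in
  [/\ (size p <= i.+1)%N, (size q <= i.+1)%N & (p`_i != 0) || (q`_i != 0)].
Proof.
move=> pq; have max_gt0 : (0 < maxn (size p) (size q))%N.
  by rewrite leq_max !size_poly_gt0.
rewrite /= prednK // leq_maxl leq_maxr; split=> //.
move: max_gt0; rewrite /maxn; case: ifP => _ s0.
  by rewrite -lead_coefE lead_coef_eq0 -size_poly_gt0 s0 orbT.
by rewrite -lead_coefE lead_coef_eq0 -size_poly_gt0 s0.
Qed.

(** The larger of the two leading monomials bounds both polynomials. This serves to treat D x and D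
    y at a common monomial. *)
Lemma lex_coef_pair U V : (U != 0) || (V != 0) ->
  exists i j c d, [/\ lex_coef U i j c, lex_coef V i j d & (c != 0) || (d != 0)].
Proof.
move=> /coef_max_size; set j := _.-1 => -[sU sV /coef_max_size].
by set i := _.-1 => -[sUj sVj cd]; exists i, j, U`_j`_i, V`_j`_i.
Qed.

End LexLeading.

Section Pbi.
Variables (k : fieldType) (m : nat) (f : nat -> {poly k}).

Fact Pbi_key : unit. Proof. exact: tt. Qed.

Definition Pbi : {poly {poly k}} :=
  locked_with Pbi_key ('X^m + \sum_(i < m.-1) (f i)%:P * 'X^i).

Lemma PbiE : Pbi = 'X^m + \sum_(i < m.-1) (f i)%:P * 'X^i.
Proof. by rewrite /Pbi unlock. Qed.

Lemma alg_eval_Ppoly (A : comAlgType k) (a b : A) :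
  alg_eval [tuple a; b] (Ppoly m f) = ev2 a b Pbi.
Proof.
have eX : alg_eval [tuple a; b] X2 = a by rewrite alg_evalX.
have eY : alg_eval [tuple a; b] Y2 = b by rewrite alg_evalX.
rewrite /Ppoly PbiE !rmorphD !rmorph_sum /= !rmorphXn /= ev2X eY.
congr (_ + _); apply: eq_bigr => i _.
by rewrite !rmorphM /= !rmorphXn /= rmorph_horner_alg /= ev2X ev2C eX eY.
Qed.

Lemma coef_Pbi i : Pbi`_i = (i == m)%:R + (if (i < m.-1)%N then f i else 0).
Proof.
rewrite PbiE coefD coefXn; congr (_ + _).
under eq_bigr do rewrite mul_polyC.
by rewrite -poly_def coef_poly.
Qed.

Lemma size_Pbi : size Pbi = m.+1.
Proof.
apply/eqP; rewrite eqn_leq; apply/andP; split.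
  apply/leq_sizeP => j mj; rewrite coef_Pbi.
  by rewrite gtn_eqF // ifF ?addr0 //; lia.
rewrite ltnNge; apply/negP => /leq_sizeP /(_ m (leqnn m)).
rewrite coef_Pbi eqxx ifF ?addr0; last by lia.
by move/eqP; rewrite oner_eq0.
Qed.

Lemma Pbi_monic : Pbi \is monic.
Proof.
by rewrite monicE lead_coefE size_Pbi coef_Pbi eqxx ifF ?addr0 //=; lia.
Qed.

End Pbi.

(** * The Danielewski algebra *)

(* The arguments only use these properties of [Balg]; an abstract [A] keeps
   unification out of the quotient. *)
Record danielewski (k : fieldType) (n m : nat) (f : nat -> {poly k})
    (A : comAlgType k) (x y z : A) : Prop := Danielewski {
  dan_rel : x ^+ n * z = ev2 x y (Pbi m f);
  dan_inj : forall U, ev2 x y U = 0 -> U = 0;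
  dan_gen : forall b, exists p : {mpoly k[3]}, b = alg_eval [tuple x; y; z] p;
  dan_univ : forall (A' : comAlgType k) (a b c : A'),
    a ^+ n * c = ev2 a b (Pbi m f) ->
    exists h : {lrmorphism A -> A'}, [/\ h x = a, h y = b & h z = c];
  dan_der : exists D : {linear A -> A},
    [/\ forall a b, D (a * b) = D a * b + a * D b, D x = 0 & D y = x ^+ n]
}.

Section Quotient.
Variables (k : fieldType) (n m : nat) (f : nat -> {poly k}).

Local Notation P := (Pbi m f).
Local Notation B := (Balg n (Ppoly m f)).
Local Notation x := (xB n (Ppoly m f)).
Local Notation y := (yB n (Ppoly m f)).
Local Notation z := (zB n (Ppoly m f)).
Local Notation toB := (@toB k n (Ppoly m f)).
Local Notation e := (ev2 x y).
Local Notation xx := ('X%:P : {poly {poly k}}).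

Lemma toB_ev2 U : toB (ev2 X3 Y3 U) = e U.
Proof. exact: rmorph_ev2. Qed.

Lemma toB_rel : toB (rel_poly n (Ppoly m f)) = 0.
Proof. by apply/eqP; rewrite toB_eq0; apply/asboolP; exists 1; rewrite mul1r. Qed.

Lemma Balg_rel : x ^+ n * z = e P.
Proof.
have : toB (X3 ^+ n * Z3) = toB (ev2 X3 Y3 P).
  apply/eqP; rewrite -subr_eq0 -rmorphB -toB_rel /rel_poly.
  by rewrite alg_eval_Ppoly.
rewrite rmorphM rmorphXn /= -[toB X3]/x -[toB Z3]/z => ->.
exact: toB_ev2.
Qed.

(** In k[x][y][z] the relation has degree 1 in z, so a nonzero multiple of it has positive degree in
    z and cannot equal U, which is free of z. *)
Lemma toB_ev2_eq0 U : e U = 0 -> U = 0.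
Proof.
rewrite -toB_ev2 => /eqP; rewrite toB_eq0 => /asboolP[q].
pose cst : {rmorphism k -> {poly {poly {poly k}}}} := polyC \o (polyC \o polyC).
have [h [hX hY hZ hC]] :
    exists h : {rmorphism {mpoly k[3]} -> {poly {poly {poly k}}}},
    [/\ h X3 = xx%:P, h Y3 = 'X%:P, h Z3 = 'X & forall c, h c%:A = c%:P%:P%:P].
  exists (mmap cst (tnth [tuple xx%:P; 'X%:P; 'X])).
  split=> [|||c] /=; rewrite ?mmapX ?mmap1U //.
  by rewrite -[c%:A]mul_mpolyC mulr1 mmapC.
have h_ev2 V : h (ev2 X3 Y3 V) = V%:P.
  elim/poly_ind: V => [|V p IH]; first by rewrite !rmorph0.
  rewrite !rmorphD !rmorphM /= ev2X hY IH ev2C; congr (_ + _).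
  elim/poly_ind: p => [|p c IHp]; first by rewrite !rmorph0.
  by rewrite !(rmorphD, rmorphM) /= horner_algX horner_algC IHp hX hC.
have h_rel : h (rel_poly n (Ppoly m f)) = (xx ^+ n)%:P * 'X - P%:P.
  by rewrite /rel_poly alg_eval_Ppoly rmorphB rmorphM !rmorphXn /= hX hZ h_ev2.
move/(congr1 h); rewrite h_ev2 rmorphM h_rel; move: (h q) => {}q E.
have sz : size ((xx ^+ n)%:P * 'X - P%:P) = 2.
  have xn0 : xx ^+ n != 0 by rewrite expf_neq0 ?polyC_eq0 ?polyX_eq0.
  by rewrite -rmorphN /= size_MXaddC size_polyC polyC_eq0 (negbTE xn0).
have [q0|q0] := eqVneq q 0.
  by apply/eqP; rewrite -polyC_eq0 E q0 mul0r.
have := congr1 (fun p => size (polyseq p)) E.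
rewrite size_mul -?size_poly_gt0 ?sz //; last by rewrite size_poly_gt0.
rewrite -size_poly_gt0 in q0; rewrite size_polyC.
by case: (size q) q0 => // s _; case: (_ != 0); rewrite addn2.
Qed.

Lemma alg_eval_id (p : {mpoly k[3]}) : alg_eval [tuple X3; Y3; Z3] p = p.
Proof.
rewrite /alg_eval /mmap [RHS]mpolyE; apply: eq_bigr => M _.
rewrite mulr_algl mpolyXE_id; congr (_ *: _); apply: eq_bigr => i _.
congr (_ ^+ _); rewrite (tnth_nth 0).
by case: i => [[|[|[|i]]] lt_i] //=; congr ('X_ _); apply: val_inj.
Qed.

Lemma toB_alg_eval p : toB p = alg_eval [tuple x; y; z] p.
Proof.
rewrite -{1}[p]alg_eval_id alg_eval_comp; congr (alg_eval _ p).
exact: val_inj.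
Qed.

Lemma toB_eq0_ex p : toB p = 0 -> exists q, p = q * rel_poly n (Ppoly m f).
Proof. by move/eqP; rewrite toB_eq0 => /asboolP. Qed.

Lemma Balg_lift (A' : comAlgType k) (a b c : A') :
  a ^+ n * c = ev2 a b P ->
  exists h : {lrmorphism B -> A'}, [/\ h x = a, h y = b & h z = c].
Proof.
move=> rel_abc.
have [ev [evX evY evZ]] : exists ev : {lrmorphism {mpoly k[3]} -> A'},
    [/\ ev X3 = a, ev Y3 = b & ev Z3 = c].
  by exists (alg_eval [tuple a; b; c]); split; rewrite /= alg_evalX.
have ev_rel q : toB q = 0 -> ev q = 0.
  move/toB_eq0_ex => [r ->].
  rewrite rmorphM /rel_poly alg_eval_Ppoly rmorphB rmorphM rmorphXn /=.
  by rewrite rmorph_ev2 /= evX evY evZ rel_abc subrr mulr0.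
have ev_toB p q : toB p = toB q -> ev p = ev q.
  move/eqP; rewrite -subr_eq0 -rmorphB => /eqP /ev_rel /eqP.
  by rewrite rmorphB subr_eq0 => /eqP.
pose h (u : B) := ev (sval (cid (toB_surj u))).
have hE p : h (toB p) = ev p by apply: ev_toB; case: cid.
have h_zmod : zmod_morphism h.
  move=> u v; have [p <-] := toB_surj u; have [q <-] := toB_surj v.
  by rewrite -rmorphB !hE rmorphB.
have h_mon : monoid_morphism h.
  split=> [|u v]; first by rewrite -(rmorph1 toB) hE rmorph1.
  have [p <-] := toB_surj u; have [q <-] := toB_surj v.
  by rewrite -rmorphM !hE rmorphM.
have h_sc : scalable h.
  move=> r u; have [p <-] := toB_surj u.
  by rewrite -linearZ !hE linearZ.
pose h' : {lrmorphism B -> A'} := HB.pack h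
  (GRing.isZmodMorphism.Build B A' h h_zmod)
  (GRing.isMonoidMorphism.Build B A' h h_mon)
  (GRing.isScalable.Build k B A' *:%R h h_sc).
by exists h'; split; rewrite -[LHS]/(h (toB _)) hE.
Qed.

(** The derivation x^n d/dy + P_y d/dz of k[x, y, z] sends x^n z - P to x^n P_y - P_y x^n = 0, so it
    preserves the ideal and descends to the quotient. *)
Lemma Balg_der : exists D : {linear B -> B},
  [/\ forall a b, D (a * b) = D a * b + a * D b, D x = 0 & D y = x ^+ n].
Proof.
have dX i : mderiv i ('X_i : {mpoly k[3]}) = 1.
  have U0 : (U_(i) - U_(i))%MM = 0%MM :> 'X_{1..3}.
    by apply/mnmP => j; rewrite mnmBE mnm0E subnn.
  by rewrite mderivX mnm1E eqxx scale1r U0 mpolyX0.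
have dXn i j : i != j -> mderiv i ('X_j : {mpoly k[3]}) = 0.
  by move=> ij; rewrite mderivX mnm1E eq_sym (negbTE ij) scale0r.
pose d p := X3 ^+ n * mderiv (@Ordinal 3 1 isT) p
  + ev2 X3 Y3 P^`() * mderiv (@Ordinal 3 2 isT) p.
have d_lin : linear d.
  by move=> c p q; rewrite /d !linearP !mulrDr -!scalerAr /=; ring.
pose d' : {linear {mpoly k[3]} -> {mpoly k[3]}} := HB.pack d
  (GRing.isLinear.Build k {mpoly k[3]} {mpoly k[3]} *:%R d d_lin).
have d_leib p q : d' (p * q) = d' p * q + p * d' q.
  by rewrite /= /d !mderivM; ring.
have d'X : d' X3 = 0 by rewrite /= /d !dXn // !mulr0 addr0.
have d'Y : d' Y3 = X3 ^+ n by rewrite /= /d dX dXn // mulr1 mulr0 addr0.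
have d'Z : d' Z3 = ev2 X3 Y3 P^`() by rewrite /= /d dX dXn // mulr1 mulr0 add0r.
move: d' d'X d'Y d'Z d_leib => {}d dX3 dY3 dZ3 d_leib {dX dXn d_lin}.
have d_rel : d (rel_poly n (Ppoly m f)) = 0.
  rewrite /rel_poly alg_eval_Ppoly linearB /= d_leib (der_ev2 d_leib).
  by rewrite (derX d_leib) dX3 dY3 dZ3 !mulr0 mul0rn mul0r !add0r mulrC subrr.
have toBd0 p : toB p = 0 -> toB (d p) = 0.
  move/toB_eq0_ex => [q ->].
  by rewrite d_leib d_rel mulr0 addr0 rmorphM /= toB_rel mulr0.
have toBd p q : toB p = toB q -> toB (d p) = toB (d q).
  move/eqP; rewrite -subr_eq0 -rmorphB => /eqP /toBd0 /eqP.
  by rewrite linearB rmorphB subr_eq0 => /eqP.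
pose D (u : B) := toB (d (sval (cid (toB_surj u)))).
have DE p : D (toB p) = toB (d p) by apply: toBd; case: cid.
have D_lin : linear D.
  move=> c u v; have [p <-] := toB_surj u; have [q <-] := toB_surj v.
  by rewrite -linearP !DE linearP linearP.
pose D' : {linear B -> B} := HB.pack D
  (GRing.isLinear.Build k B B *:%R D D_lin).
exists D'; split=> [u v| |].
- have [p <-] := toB_surj u; have [q <-] := toB_surj v.
  rewrite -rmorphM -[D' _]/(D _) -[D' (toB p)]/(D _) -[D' (toB q)]/(D _) !DE.
  by rewrite d_leib rmorphD !rmorphM.
- by rewrite -[LHS]/(D (toB X3)) DE dX3 rmorph0.
- by rewrite -[LHS]/(D (toB Y3)) DE dY3 rmorphXn.
Qed.

Lemma Balg_danielewski : danielewski n m f x y z.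
Proof.
split; [exact: Balg_rel|exact: toB_ev2_eq0| |exact: Balg_lift|exact: Balg_der].
by move=> b; have [p <-] := toB_surj b; exists p; apply: toB_alg_eval.
Qed.

End Quotient.

(** * Fractions and normal forms *)

Section Structure.
Variables (k : fieldType) (n m : nat) (f : nat -> {poly k}).
Variables (B : comAlgType k) (x y z : B).
Hypothesis m_gt0 : (0 < m)%N.
Hypothesis dan : danielewski n m f x y z.

Local Notation P := (Pbi m f).
Local Notation e := (ev2 x y).
Local Notation xx := ('X%:P : {poly {poly k}}).
Implicit Types U V : {poly {poly k}}.

Lemma ev2xX l : e (xx ^+ l) = x ^+ l.
Proof. by rewrite ev2Xn ev2C horner_algX. Qed.

Lemma dan_ev2_inj U V : e U = e V -> U = V.
Proof.
move=> UV; apply/eqP; rewrite -subr_eq0; apply/eqP/(dan_inj dan).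
by rewrite ev2B UV subrr.
Qed.

(* [b] is a sum of terms [r(x, y) z^t] with [r] of degree less than [m] in [y]. *)
Definition normal_form (b : B) := exists rho : {poly {poly {poly k}}},
  (forall t, (size (rho`_t)%R <= m)%N) /\ b = (map_poly e rho).[z].

Lemma normal_form0 : normal_form 0.
Proof.
by exists 0; split=> [t|]; rewrite ?coef0 ?size_poly0 // map_poly0 horner0.
Qed.

Lemma normal_formD b c : normal_form b -> normal_form c -> normal_form (b + c).
Proof.
move=> [r [sr ->]] [s [ss ->]]; exists (r + s); split=> [t|].
  by rewrite coefD (leq_trans (size_polyD _ _)) // geq_max sr ss.
by rewrite rmorphD hornerD.
Qed.

Lemma normal_form_sum (I : Type) (r : seq I) (F : I -> B) :
  (forall i, normal_form (F i)) -> normal_form (\sum_(i <- r) F i).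
Proof.
by move=> nF; elim/big_ind: _ => //; [exact: normal_form0|exact: normal_formD].
Qed.

Lemma normal_form_monom U t : (size U <= m)%N -> normal_form (e U * z ^+ t).
Proof.
move=> sU; exists (U%:P * 'X^t); split=> [i|].
  by rewrite coefCM coefXn; case: eqP; rewrite ?mulr1 ?mulr0 ?size_poly0.
by rewrite rmorphM /= map_polyC map_polyXn hornerM hornerC hornerXn.
Qed.

Lemma normal_form_stable (c : B) :
  (forall (U : {poly {poly k}}) t, (size U <= m)%N ->
    normal_form (c * (e U * z ^+ t))) ->
  forall b, normal_form b -> normal_form (c * b).
Proof.
move=> nc _ [rho [srho ->]].
rewrite (horner_coef_wide _ (size_poly _ _)) mulr_sumr.
apply: normal_form_sum => i; by rewrite coef_map; apply: nc.
Qed.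

(** Normal forms contain the constants and are stable under multiplication by the generators x, y
    and z. *)
Lemma normal_form_ex b : normal_form b.
Proof.
have nz : forall b, normal_form b -> normal_form (z * b).
  apply: normal_form_stable => U t sU.
  by rewrite mulrCA -exprS; apply: normal_form_monom.
have nx : forall b, normal_form b -> normal_form (x * b).
  apply: normal_form_stable => U t sU.
  have -> : x * (e U * z ^+ t) = e (xx * U) * z ^+ t.
    by rewrite ev2M ev2C horner_algX mulrA.
  apply: normal_form_monom.
  apply/leq_sizeP => j mj; rewrite coefCM.
  by move/leq_sizeP: sU => ->; rewrite ?mulr0.
have ny : forall b, normal_form b -> normal_form (y * b).
  apply: normal_form_stable => U t sU.
  (* Subtracting c P from y U cancels its term in y^m, and c P = c x^n z goes to the next power of
     z. *)
  pose c : {poly {poly k}} := (U`_m.-1)%:P.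
  have -> : y * (e U * z ^+ t) =
      e ('X * U - c * P) * z ^+ t + e (c * xx ^+ n) * z ^+ t.+1.
    have reduce_mul (R : comNzRingType) (a u w v t1 t2 : R) :
      a * (u * t2) = (a * u - w * (v * t1)) * t2 + w * v * (t1 * t2) by ring.
    rewrite ev2B !ev2M ev2X -(dan_rel dan) ev2xX [z ^+ t.+1]exprS.
    exact: reduce_mul.
  apply: normal_formD; apply: normal_form_monom.
    apply/leq_sizeP => j mj; rewrite coefB coefXM coefCM coef_Pbi.
    case: j mj => [|j] mj; first by lia.
    rewrite /= [in if _ then _ else _]ifF; last by lia.
    have [jm|jm] := eqVneq j.+1 m; first by rewrite -jm /= addr0 mulr1 subrr.
    rewrite addr0 mulr0 subr0; move/leq_sizeP: sU; apply.
    by move/eqP: jm; lia.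
  rewrite /c -!rmorphXn -rmorphM (leq_trans (size_polyC_leq1 _)) //.
have [p ->] := dan_gen dan b.
elim/mpolyind: p => [|c M p _ _ IH].
  by rewrite rmorph0; apply: normal_form0.
rewrite rmorphD /=; apply: normal_formD => //.
have n_iter (a : B) l u : (forall v, normal_form v -> normal_form (a * v)) ->
    normal_form u -> normal_form (a ^+ l * u).
  move=> na nu; elim: l => [|l IHl]; rewrite ?expr0 ?mul1r // exprS -mulrA.
  exact: na.
have -> : alg_eval [tuple x; y; z] (c *: 'X_[M]) =
   x ^+ M (@Ordinal 3 0 isT) * (y ^+ M (@Ordinal 3 1 isT) *
   (z ^+ M (@Ordinal 3 2 isT) * (e c%:P%:P * z ^+ 0))).
  rewrite linearZ mpolyXE_id rmorph_prod !big_ord_recl big_ord0 !rmorphXn /=.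
  rewrite !alg_evalX mulr1 expr0 mulr1 ev2C horner_algC mulr_algr !scalerAr.
  congr (_ ^+ M _ * (_ ^+ M _ * (_ *: _ ^+ M _))); exact: val_inj.
do 3 (apply: (n_iter); first by []).
apply: normal_form_monom.
by rewrite (leq_trans (size_polyC_leq1 _)).
Qed.

Lemma size_xxM l U : size (xx ^+ l * U) = size U.
Proof. by rewrite -rmorphXn /= size_Cmul // expf_neq0 // polyX_eq0. Qed.

Lemma size_Pbi_exp i : size (P ^+ i) = (m * i).+1.
Proof.
have := size_exp P i; rewrite size_Pbi /= => <-.
by rewrite prednK // size_poly_gt0 monic_neq0 // monic_exp // Pbi_monic.
Qed.

(** T is the degree in z of a normal form. Multiplying by x^(n T) turns its term r_i z^i into x^(n
    (T - i)) r_i P^i, whose y-degree lies in [m i, m i + m) if r_i is nonzero. The top term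
    dominates, so T is the quotient by m of the y-degree of G. *)
Lemma clear_denominators b : b = 0 \/ exists T (G : {poly {poly k}}),
  [/\ x ^+ (n * T) * b = e G, (m * T < size G)%N & (size G <= m * T + m)%N].
Proof.
have [rho [srho ->]] := normal_form_ex b.
have [->|rho0] := eqVneq rho 0; first by left; rewrite map_poly0 horner0.
right; pose T := (size rho).-1.
have sT : size rho = T.+1 by rewrite prednK // size_poly_gt0.
pose F i := xx ^+ (n * (T - i)) * (rho`_i * P ^+ i).
exists T, (\sum_(i < T.+1) F i).
have sF i : rho`_i != 0 -> size (F i) = (m * i + size (rho`_i)%R)%N.
  move=> r0; rewrite /F size_xxM size_Mmonic ?monic_exp ?Pbi_monic //.
  by rewrite size_Pbi_exp addnS addnC.
have lt_sum : (size (\sum_(i < T) F i)%R <= m * T)%N.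
  apply: leq_trans (size_sum _ _ _) _; apply/bigmax_leqP => i _.
  have [r0|r0] := eqVneq rho`_i 0; first by rewrite /F r0 mul0r mulr0 size_poly0.
  rewrite sF // (leq_trans (leq_add (leqnn _) (srho _))) //.
  by rewrite -mulnSr leq_mul2l ltn_ord orbT.
have rT0 : rho`_T != 0 by rewrite -lead_coefE lead_coef_eq0.
have sFT := sF _ rT0.
have rT_gt : (0 < size (rho`_T)%R)%N by rewrite size_poly_gt0.
have sG : size (\sum_(i < T.+1) F i) = (m * T + size (rho`_T)%R)%N.
  rewrite big_ord_recr /= addrC size_polyDl sFT //.
  by apply: leq_ltn_trans lt_sum _; rewrite -[X in (X < _)%N]addn0 ltn_add2l.
split; last 2 first.
- by rewrite sG -[X in (X < _)%N]addn0 ltn_add2l.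
- by rewrite sG leq_add2l srho.
rewrite (horner_coef_wide _ (size_poly _ _)) sT mulr_sumr ev2_sum.
apply: eq_bigr => i _.
rewrite coef_poly ltn_ord /F !ev2M ev2xX ev2Xn -(dan_rel dan) /=.
have iT : (i <= T)%N by rewrite -ltnS.
rewrite -{1}(subnK iT) mulnDr exprD exprMn -exprM.
by rewrite -!mulrA; congr (_ * _); rewrite mulrCA.
Qed.

Lemma mulxX_eq0 l b : x ^+ l * b = 0 -> b = 0.
Proof.
have [//|[T [G [bG sG _]]] xb0] := clear_denominators b.
have : e (xx ^+ l * G) = 0 by rewrite ev2M ev2xX -bG mulrCA xb0 mulr0.
move/(dan_inj dan)/(congr1 (fun U : {poly {poly k}} => size U)).
by rewrite size_xxM size_poly0 => G0; rewrite G0 in sG.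
Qed.

Lemma mulxX_inj l b c : x ^+ l * b = x ^+ l * c -> b = c.
Proof.
move=> bc; apply/eqP; rewrite -subr_eq0; apply/eqP/(@mulxX_eq0 l).
by rewrite mulrBr bc subrr.
Qed.

Lemma fraction_ex b : exists K U, x ^+ K * b = e U.
Proof.
have [->|[T [G [bG _ _]]]] := clear_denominators b; last by exists (n * T)%N, G.
by exists 0%N, 0; rewrite mulr0 ev2_0.
Qed.

(** A numerator of y-degree below m forces T = 0 in [clear_denominators], so b already lies in
    k[x, y]. *)
Lemma small_fraction K b U : x ^+ K * b = e U -> (size U <= m)%N ->
  exists2 V, U = xx ^+ K * V & b = e V.
Proof.
move=> bU sU; have [b0|[T [G [bG sG _]]]] := clear_denominators b.
  exists 0; last by rewrite b0 ev2_0.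
  by rewrite mulr0; apply/(dan_inj dan); rewrite -bU b0 mulr0.
have GU : xx ^+ K * G = xx ^+ (n * T) * U.
  by apply: dan_ev2_inj; rewrite !ev2M !ev2xX -bG -bU mulrCA.
have T0 : T = 0%N.
  have sGU : size G = size U by rewrite -(size_xxM K) GU size_xxM.
  move: (leq_trans sG (leq_trans (eq_leq sGU) sU)).
  by rewrite -[X in (_ < X)%N]muln1 ltn_mul2l m_gt0; case: (T).
move: bG GU; rewrite T0 muln0 !expr0 !mul1r => -> GU.
by exists G.
Qed.

(** In [clear_denominators] T is [j %/ m], and x^K G = x^(n T) U; it remains to compare the
    x-degrees of the coefficients of y^j. This is the inequality of the cone. *)
Lemma fraction_exponents K b U u j c : x ^+ K * b = e U -> lex_coef U u j c ->
  c != 0 -> (K <= u + n * (j %/ m))%N.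
Proof.
move=> bU [sU sUj Uc] c0.
have Uj0 : U`_j != 0 by apply: contraNneq c0 => U0; rewrite -Uc U0 coef0.
have sUE : size U = j.+1.
  apply/eqP; rewrite eqn_leq sU ltnNge.
  apply/negP => /leq_sizeP/(_ j (leqnn j)) /eqP.
  by rewrite (negbTE Uj0).
have sUjE : size (U`_j)%R = u.+1.
  apply/eqP; rewrite eqn_leq sUj ltnNge.
  apply/negP => /leq_sizeP/(_ u (leqnn u)) /eqP.
  by rewrite Uc (negbTE c0).
have [b0|[T [G [bG sG sG']]]] := clear_denominators b.
  have : e U = e 0 by rewrite -bU b0 mulr0 ev2_0.
  by move/dan_ev2_inj => U0; rewrite U0 coef0 eqxx in Uj0.
have GU : xx ^+ K * G = xx ^+ (n * T) * U.
  by apply: dan_ev2_inj; rewrite !ev2M !ev2xX -bG -bU mulrCA.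
have sGU : size G = j.+1 by rewrite -(size_xxM K) GU size_xxM.
have -> : (j %/ m = T)%N.
  apply/eqP; rewrite eqn_leq leq_divRL // -ltnS ltn_divLR //.
  by move: sG sG'; rewrite sGU mulSn; lia.
have := congr1 (fun V : {poly {poly k}} => size (V`_j)%R) GU.
rewrite -!rmorphXn /= !coefCM; set g := G`_j.
have g0 : g != 0.
  rewrite /g -[j]/(j.+1.-1) -sGU -lead_coefE lead_coef_eq0.
  by rewrite -size_poly_gt0 sGU.
rewrite ['X^_ * g]mulrC ['X^_ * U`_j]mulrC !size_mulXn // sUjE => E.
have : (K + 1 <= K + size g)%N by rewrite leq_add2l size_poly_gt0.
by rewrite E; lia.
Qed.

End Structure.

(** * Locally nilpotent derivations *)

(* [l1, l2, l3] are the weights of [x, y, z] for a locally nilpotent monomial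
   derivation with shift [(p, q)], which preserves the cone spanned by [(1, 0)]
   and [(- n, m)]; such a derivation kills [x]. *)
Lemma no_root_across_cone (n m l1 l2 l3 t t' : nat) (p : int) (q : nat) :
  (1 < n)%N -> (1 < m)%N -> (m * l2 = n * l1 + l3)%N ->
  l1%:Z * p + l2%:Z * q%:Z = - 1 ->
  (m * t <= q < m * t + m)%N -> (m * t' <= q.+1 < m * t' + m)%N ->
  0 <= 1 + p + n%:Z * t%:Z -> 0 <= p + n%:Z * t'%:Z -> l1 = 0%N.
Proof.
move=> n1 m1 E1 E2 /andP[t_le t_gt] /andP[t'_le t'_gt] Sx Sy.
case: l1 E1 E2 => // l1; set a := l1.+1 => E1 E2; exfalso.
have Eq : (t' = t \/ (t' = t.+1 /\ q.+1 = m * t + m))%N by nia.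
case: Eq => [Et|[Et Eq]]; rewrite Et in Sy.
  (* With equal quotients, the condition on the image of y gives l1 p >= - n l1 t >= - m l2 t >= -
     l2 q, against l1 p + l2 q = -1. *)
  have H1 : l1.+1%:Z * (p + n%:Z * t%:Z) >= 0 by nia.
  have H2 : (n * a * t <= m * l2 * t)%N by rewrite E1; nia.
  have H3 : (m * l2 * t <= l2 * q)%N by nia.
  nia.
(* Otherwise q + 1 = m t + m, and the condition on the image of x gives 1 + m l2 <= a + l2, while n,
   m > 1 give 2 a <= m l2 and 2 l2 <= m l2. *)
have H1 : a%:Z * (1 + p + n%:Z * t%:Z) >= 0 by nia.
have H2 : (n * a * t <= m * l2 * t)%N by rewrite E1; nia.
have H3 : (l2 * q + l2 = l2 * m * t + l2 * m)%N by nia.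
have H4 : (1 + l2 * m <= a + l2)%N by nia.
have H5 : (n * a <= m * l2)%N by nia.
have H6 : (2 * a <= n * a)%N by nia.
nia.
Qed.

Section Rigidity.
Variables (k : fieldType) (n m : nat) (f : nat -> {poly k}).
Variables (B : comAlgType k) (x y z : B).
Hypothesis char0 : [pchar k] =i pred0.
Hypotheses (n_gt1 : (1 < n)%N) (m_gt1 : (1 < m)%N).
Hypothesis dan : danielewski n m f x y z.

Local Notation P := (Pbi m f).
Local Notation e := (ev2 x y).
Local Notation xx := ('X%:P : {poly {poly k}}).
Local Notation dx := (map_poly (@deriv k)).
Implicit Types U V : {poly {poly k}}.

Let m_gt0 : (0 < m)%N. Proof. exact: ltnW. Qed.

(* [b] has leading monomial [x^i y^j] in [k[x, 1/x, y]], for the lexicographic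
   order in which [y] dominates. *)
Definition leading b (i j : int) := exists (K : nat) U (u v : nat) c,
  [/\ x ^+ K * b = e U, lex_coef U u v c, c != 0, i = u%:Z - K%:Z & j = v%:Z].

Lemma lex_coef_neq0 U u v c : lex_coef U u v c -> c != 0 -> U`_v != 0.
Proof. by move=> [_ _ <-]; apply: contraNneq => ->; rewrite coef0. Qed.

Lemma leading_neq0 b i j : leading b i j -> b <> 0.
Proof.
move=> [K [U [u [v [c [bU lU c0 _ _]]]]]] b0.
have /(dan_inj dan) U0 : e U = 0 by rewrite -bU b0 mulr0.
by have := lex_coef_neq0 lU c0; rewrite U0 coef0 eqxx.
Qed.

Lemma leading_cone b i j : leading b i j ->
  exists v t : nat, [/\ j = v%:Z, (m * t <= v < m * t + m)%N
                      & 0 <= i + n%:Z * t%:Z].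
Proof.
move=> [K [U [u [v [c [bU lU c0 -> ->]]]]]].
exists v, (v %/ m)%N; split=> //.
  by rewrite mulnC leq_divM -mulSnr ltn_ceil.
by have := fraction_exponents m_gt0 dan bU lU c0; nia.
Qed.

Lemma leading_x : leading x 1 0.
Proof.
exists 0%N, xx, 1%N, 0%N, 1; split=> //; first by rewrite mul1r ev2C horner_algX.
  by split; rewrite ?coefC ?size_polyX ?coefX // (leq_trans (size_polyC_leq1 _)).
exact: oner_neq0.
Qed.

Lemma leading_y : leading y 0 1.
Proof.
exists 0%N, 'X, 0%N, 1%N, 1; split=> //; first by rewrite mul1r ev2X.
  by split; rewrite ?size_polyX ?coefX ?size_poly1 ?coef1.
exact: oner_neq0.
Qed.

Lemma leading_z : leading z (- n%:Z) m.
Proof.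
exists n, P, 0%N, m, 1; split; rewrite ?sub0r //; first exact: (dan_rel dan).
  have Pm : P`_m = 1.
    by move/monicP: (Pbi_monic m f); rewrite lead_coefE size_Pbi.
  by split; rewrite ?size_Pbi ?Pm ?size_poly1 ?coef1.
exact: oner_neq0.
Qed.

Variable D : {linear B -> B}.
Hypothesis leibniz : forall a b, D (a * b) = D a * b + a * D b.

Section LeadingForm.
Variables (N : nat) (A C : {poly {poly k}}).
Hypotheses (DxA : x ^+ N * D x = e A) (DyC : x ^+ N * D y = e C).

(* The numerator in [D (U / x^K) = der_num K U / x^(K + N + 1)]. *)
Definition der_num K U :=
  A * (xx * dx U) + xx * C * U^`() - A * U *+ K.

Lemma der_fraction K b U : x ^+ K * b = e U ->
  x ^+ (K + N.+1) * D b = e (der_num K U).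
Proof.
move=> bU.
(* The factor x^N clears the denominators of D x and D y; one more x compensates the exponent K - 1
   coming from D (x^K). *)
have /(congr1 ( *%R (x ^+ N.+1))) := congr1 D bU.
rewrite leibniz (derX leibniz) (der_ev2 leibniz) => E.
rewrite /der_num ev2B ev2D ev2Mn !ev2M -DxA -DyC -bU.
have ex : e xx = x by rewrite ev2C horner_algX.
rewrite ex; move: E; move: (e (dx U)) (e U^`()) => d1 d2.
have -> : x ^+ N.+1 * (x ^+ K.-1 * D x *+ K * b + x ^+ K * D b)
   = x ^+ N * D x * (x ^+ K * b) *+ K + x ^+ (K + N.+1) * D b.
  case: (K) => [|K'].
    by rewrite !mulr0n mul0r !add0r mul1r add0n.
  rewrite /= mulrDr; congr (_ + _).
    by rewrite mulrnAl mulrnAr; congr (_ *+ _); rewrite !exprS; ring.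
  by rewrite addnC exprD mulrA.
move=> E; apply: (addrI (x ^+ N * D x * (x ^+ K * b) *+ K)).
by rewrite E [RHS]addrC subrK exprS; ring.
Qed.

Variables (R Q : nat) (alpha gamma : k).
Hypotheses (lexA : lex_coef ('X * A) R Q alpha).
Hypotheses (lexC : lex_coef (xx * C) R Q gamma).

(** D x / x and D y / y have coefficients [alpha] and [gamma] at x^p y^q and no larger monomial:
    [lexA] and [lexC] describe their numerators over the common denominator x^(N+1) y. *)
Local Notation p := (R%:Z - N%:Z - 1).
Local Notation q := (Q%:Z - 1).

(** D multiplies x^i y^j by i D x / x + j D y / y, whose coefficient at x^p y^q is the linear form;
    if it is nonzero, nothing cancels at the top. *)
Lemma leading_der b i j : leading b i j ->
  alpha * i%:~R + gamma * j%:~R != 0 -> leading (D b) (i + p) (j + q).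
Proof.
move=> [K [U [u [v [c [bU lU c0 -> ->]]]]]] nz.
pose W := der_num K U.
(* The extra factor y makes [lexA] applicable and turns d/dy into the Euler operator. *)
have lW : lex_coef ('X * W) (R + u) (Q + v)
    (c * (alpha * (u%:Z - K%:Z)%:~R + gamma * v%:~R)).
  have -> : 'X * W = 'X * A * (xx * dx U) + xx * C * ('X * U^`())
      + ('X * A * U *+ K) * (-1)%:P%:P.
    by rewrite /W /der_num !rmorphN /= !polyC1; ring.
  have -> : c * (alpha * (u%:Z - K%:Z)%:~R + gamma * v%:~R) =
      alpha * (c *+ u) + gamma * (c *+ v) + (alpha * c *+ K) * (-1).
    rewrite rmorphB /= -!pmulrn -[c *+ u]mulr_natr -[c *+ v]mulr_natr.
    by rewrite -[_ *+ K]mulr_natr; ring.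
  have lex1 : lex_coef (- 1)%:P%:P 0 0 (-1 : k).
    by split; rewrite ?coefC //= ?(leq_trans (size_polyC_leq1 _)).
  rewrite -[(R + u)%N]addn0 -[(Q + v)%N]addn0.
  apply: lex_coefD; last by apply: lex_coefM => //; apply/lex_coefMn/lex_coefM.
  rewrite !addn0; apply: lex_coefD.
    exact/lex_coefM/lex_coef_thetax.
  exact/lex_coefM/lex_coef_thetay.
set d := c * _ in lW; have d0 : d != 0 by rewrite mulf_neq0.
(* y W has no term free of y, so the factor y can be divided out again. *)
have Qv : (0 < Q + v)%N.
  rewrite lt0n; apply/eqP => Qv; have := lex_coef_neq0 lW d0.
  by rewrite Qv coefXM /= eqxx.
case: lW => sW; rewrite !coefXM (gtn_eqF Qv) => sWj Wj.
exists (K + N.+1)%N, W, (R + u)%N, (Q + v).-1, d; split=> //.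
- exact: der_fraction.
- split=> //.
  have [W0|W0] := eqVneq W 0; first by rewrite W0 size_poly0.
  by move: sW; rewrite mulrC size_mulX // prednK.
- by rewrite !PoszD; lia.
- by rewrite -!subn1; lia.
Qed.

(** While the linear form is nonzero, the leading monomial moves by (p, q) and the iterate stays
    nonzero; so the form vanishes somewhere along the way. *)
Lemma leading_nilpotent b i j l : leading b i j -> iter l D b = 0 ->
  exists s : nat, alpha * (i + s%:Z * p)%:~R + gamma * (j + s%:Z * q)%:~R = 0.
Proof.
elim: l b i j => [|l IH] b i j lb Db; first by case: (leading_neq0 lb).
have [nz|nz] := eqVneq (alpha * i%:~R + gamma * j%:~R) 0.
  by exists 0%N; rewrite !mul0r !addr0.
have [|s Es] := IH (D b) _ _ (leading_der lb nz); first by rewrite -iterSr.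
exists s.+1; rewrite -Es -!addrA; congr (_ * _%:~R + _ * _%:~R); lia.
Qed.

Hypothesis nilp : forall b, exists l, iter l D b = 0.

(** Let l1, l2, l3 be the numbers of shifts that [leading_nilpotent] gives for x, y, z, and L0 the
    value of the linear form at (p, q). Then alpha = - l1 L0 and gamma = - l2 L0, so L0 is nonzero,
    and in characteristic zero l1 p + l2 q = -1 and m l2 = n l1 + l3. The cone forces l1 = 0; then
    l2 q = -1 with q >= -1 gives q = -1. *)
Lemma leading_form : (alpha != 0) || (gamma != 0) -> Q = 0%N.
Proof.
move=> ag.
have [p0 Ep] : exists p0 : int, p0 = p by exists p.
have [q0 Eq] : exists q0 : int, q0 = q by exists q.
have zero b i j : leading b i j -> exists s : nat,
    alpha * (i + s%:Z * p0)%:~R + gamma * (j + s%:Z * q0)%:~R = 0.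
  rewrite Ep Eq.
  by move=> lb; have [l Dl] := nilp b; apply: leading_nilpotent lb Dl.
pose L0 := alpha * p0%:~R + gamma * q0%:~R.
have [l1 E1] := zero _ _ _ leading_x; have [l2 E2] := zero _ _ _ leading_y.
have [l3 E3] := zero _ _ _ leading_z.
have expand (i s t : int) : (i + s * t)%:~R = i%:~R + s%:~R * t%:~R :> k.
  by rewrite intrD intrM.
have {}E1 : alpha = - (l1%:Z%:~R * L0).
  by apply/eqP; rewrite -subr_eq0 opprK -E1 /L0 !expand; apply/eqP; ring.
have {}E2 : gamma = - (l2%:Z%:~R * L0).
  by apply/eqP; rewrite -subr_eq0 opprK -E2 /L0 !expand; apply/eqP; ring.
have L0_neq0 : L0 != 0.
  by apply: contraTneq ag => L00; rewrite E1 E2 L00 !mulr0 oppr0 eqxx.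
have L0E : L0 = - (l1%:Z * p0 + l2%:Z * q0)%:~R * L0.
  rewrite {1}/L0 {1}E1 {1}E2 intrD !intrM.
  by move: (p0%:~R) (q0%:~R) => a b; ring.
have H1 : l1%:Z * p0 + l2%:Z * q0 = - 1.
  apply/eqP; rewrite -subr_eq0 opprK -(char0_intr_eq0 char0).
  rewrite -(mulIr_eq0 _ (mulIf L0_neq0)) intrD mulrDl mul1r {2}L0E mulNr.
  by rewrite subrr.
have H3 : (m * l2 = n * l1 + l3)%N.
  apply/eqP; rewrite -eqz_nat -subr_eq0 -(char0_intr_eq0 char0).
  rewrite -(mulIr_eq0 _ (mulIf L0_neq0)); apply/eqP; rewrite -[RHS]oppr0 -E3.
  rewrite !expand.
  have -> : alpha * ((- n%:Z)%:~R + l3%:Z%:~R * p0%:~R)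
      + gamma * (m%:Z%:~R + l3%:Z%:~R * q0%:~R)
      = alpha * (- n%:Z)%:~R + gamma * m%:Z%:~R + l3%:Z%:~R * L0.
    by rewrite /L0; move: (p0%:~R) (q0%:~R) => a b; ring.
  rewrite E1 E2 intrB !PoszD !PoszM intrD !intrM rmorphN /=; ring.
(* If l1 > 0 then l2 > 0 too, so [alpha] and [gamma] are nonzero and the shifted monomials of x and
   y are leading monomials of D x and D y, hence in the cone. *)
have l10 : l1 = 0%N.
  apply/eqP; rewrite -leqn0 leqNgt; apply/negP => l1_gt0.
  have l2_gt0 : (0 < l2)%N by nia.
  have cone b i j : leading b i j -> alpha * i%:~R + gamma * j%:~R != 0 ->
      exists v t : nat, [/\ j + q0 = v%:Z, (m * t <= v < m * t + m)%N
                       & 0 <= i + p0 + n%:Z * t%:Z].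
    by rewrite Ep Eq => lb nz; apply: leading_cone (leading_der lb nz).
  have l_neq0 l : (0 < l)%N -> - (l%:Z%:~R * L0) != 0.
    move=> l_gt0; rewrite oppr_eq0 mulf_neq0 // char0_intr_eq0 //.
    by rewrite eqz_nat -lt0n.
  have [|v [t [Ev vt Sx]]] := cone _ _ _ leading_x.
    by rewrite mulr1 mulr0 addr0 E1 l_neq0.
  have [|v' [t' [Ev' vt' Sy]]] := cone _ _ _ leading_y.
    by rewrite mulr1 mulr0 add0r E2 l_neq0.
  have Ev1 : v' = v.+1 by lia.
  rewrite Ev1 in vt'; rewrite add0r in Sy.
  have E : l1%:Z * p0 + l2%:Z * v%:Z = - 1 by rewrite -Ev add0r.
  by have := no_root_across_cone n_gt1 m_gt1 H3 E vt vt' Sx Sy; lia.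
move: H1; rewrite l10 mul0r add0r => H1.
by move: Eq; nia.
Qed.
End LeadingForm.

Lemma der_rel V : D x = 0 -> D y = e V -> x ^+ n * D z = e (P^`() * V).
Proof.
move=> Dx Dy; have := congr1 D (dan_rel dan).
rewrite leibniz (derX leibniz) (der_ev2 leibniz) Dx Dy !mulr0 mul0rn mul0r.
by rewrite !add0r ev2M.
Qed.

Hypothesis nilp : forall b, exists l, iter l D b = 0.

(** If the numerator A of D x were nonzero, [leading_form] would give Q = 0, bounding the y-degree
    of y A by 0. *)
Lemma nilpotent_der_x : D x = 0.
Proof.
have [N1 [A DxA]] := fraction_ex m_gt0 dan (D x).
have [N2 [C DyC]] := fraction_ex m_gt0 dan (D y).
have {}DxA : x ^+ (N1 + N2) * D x = e (xx ^+ N2 * A).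
  by rewrite ev2M ev2xX -DxA addnC exprD mulrA.
have {}DyC : x ^+ (N1 + N2) * D y = e (xx ^+ N1 * C).
  by rewrite ev2M ev2xX -DyC exprD mulrA.
move: (N1 + N2)%N (xx ^+ N2 * A) (xx ^+ N1 * C) DxA DyC => N {}A {}C DxA DyC.
suff A0 : A = 0 by apply: (mulxX_eq0 m_gt0 dan (l := N)); rewrite DxA A0 ev2_0.
have [//|A0] := eqVneq A 0.
have XA0 : 'X * A != 0 by rewrite mulf_neq0 ?polyX_eq0.
have := @lex_coef_pair _ ('X * A) (xx * C); rewrite XA0 => /(_ isT).
move=> [R [Q [a [c [lA lC ac]]]]].
have Q0 := leading_form DxA DyC lA lC nilp ac.
case: lA => sA _ _; move: sA; rewrite Q0 mulrC size_mulX //.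
by rewrite ltnS leqn0 size_poly_eq0 (negbTE A0).
Qed.

(** By [leading_form], D y is a polynomial v in x alone. Then x^n D z = P_y v has y-degree below m,
    so x^n divides P_y v, whose coefficient of y^(m-1) is m v. *)
Lemma nilpotent_der_y : exists h, D y = e (xx ^+ n * h%:P).
Proof.
have Dx := nilpotent_der_x.
have [N [C DyC]] := fraction_ex m_gt0 dan (D y).
have [C0|C0] := eqVneq C 0.
  exists 0; rewrite mulr0 ev2_0; apply: (mulxX_eq0 m_gt0 dan (l := N)).
  by rewrite DyC C0 ev2_0.
have DxA : x ^+ N * D x = e 0 by rewrite Dx mulr0 ev2_0.
have XC0 : xx * C != 0 by rewrite mulf_neq0 // polyC_eq0 polyX_eq0.
have := @lex_coef_pair _ ('X * 0) (xx * C); rewrite XC0 orbT => /(_ isT).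
move=> [R [Q [a [c [lA lC ac]]]]].
have Q0 := leading_form DxA DyC lA lC nilp ac.
have sC : (size C <= 1)%N by case: lC; rewrite Q0 -[xx]expr1 size_xxM.
have [V CV DyV] := small_fraction m_gt0 dan DyC (leq_trans sC m_gt0).
have sV : (size V <= 1)%N by rewrite -(size_xxM N V) -CV.
rewrite (size1_polyC sV) in CV DyV; set v := V`_0 in CV DyV.
have [] := small_fraction m_gt0 dan (der_rel Dx DyV).
  rewrite mulrC mul_polyC (leq_trans (size_scale_leq _ _)) //.
  by have := lt_size_deriv (monic_neq0 (Pbi_monic m f)); rewrite size_Pbi.
move=> W EW _.
have /(congr1 (fun U : {poly {poly k}} => m%:R^-1 *: U`_m.-1)) := EW.
rewrite -rmorphXn /= coefMC coefCM coef_deriv prednK //.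
have Pm : P`_m = 1.
  by move/monicP: (Pbi_monic m f); rewrite lead_coefE size_Pbi.
rewrite Pm mulr_natl -scaler_nat scalerA mulVf; last first.
  by rewrite char0_natr_eq0 // -lt0n.
rewrite scale1r.
move=> Ev; exists (m%:R^-1 *: W`_m.-1).
by rewrite DyV Ev -polyCM -scalerAr.
Qed.

End Rigidity.

(** * The standard derivation and its kernel *)

Section StandardDerivation.
Variables (k : fieldType) (n m : nat) (f : nat -> {poly k}).
Variables (B : comAlgType k) (x y z : B).
Hypothesis char0 : [pchar k] =i pred0.
Hypotheses (m_gt0 : (0 < m)%N) (dan : danielewski n m f x y z).

Local Notation e := (ev2 x y).
Local Notation xx := ('X%:P : {poly {poly k}}).

(** On numerators D acts as x^n d/dy, so it is locally nilpotent; in characteristic zero an element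
    of its kernel has a numerator free of y, and [small_fraction] puts it in k[x]. *)
Lemma standard_der : exists D : {linear B -> B},
  [/\ forall a b, D (a * b) = D a * b + a * D b, D y = x ^+ n,
      forall b, exists l, iter l D b = 0
    & forall b, D b = 0 -> exists p, b = horner_alg x p].
Proof.
have [D [leibniz Dx Dy]] := dan_der dan; exists D.
have De U : D (e U) = e (xx ^+ n * U^`()).
  by rewrite (der_ev2 leibniz) Dx Dy mulr0 add0r ev2M ev2xX mulrC.
have DxX K b : D (x ^+ K * b) = x ^+ K * D b.
  by rewrite leibniz (derX leibniz) Dx mulr0 mul0rn mul0r add0r.
split=> // b; have [K [U bU]] := fraction_ex m_gt0 dan b.
  exists (size U); apply: (mulxX_eq0 m_gt0 dan (l := K)).
  have -> : x ^+ K * iter (size U) D b = e (xx ^+ (n * size U) * U^`(size U)).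
    elim: (size U) => [|l IH]; first by rewrite muln0 mul1r derivn0.
    rewrite iterS -DxX IH De derivnS mulnS exprD -mulrA; congr (e (_ * _)).
    by rewrite -rmorphXn /= mul_polyC derivZ -mul_polyC.
  by rewrite derivn_poly0 // mulr0 ev2_0.
move=> Db; have U'0 : U^`() = 0.
  apply/eqP; rewrite -size_poly_eq0 -(size_xxM n) size_poly_eq0.
  by apply/eqP/(dan_inj dan); rewrite -De -bU DxX Db mulr0.
have sU : (size U <= 1)%N by apply: size_le_deriv => //; rewrite U'0 size_poly0.
have [V UV ->] := small_fraction m_gt0 dan bU (leq_trans sU m_gt0).
have sV : (size V <= 1)%N by rewrite -(size_xxM K) -UV.
by exists V`_0; rewrite (size1_polyC sV) ev2C coefC.
Qed.

Lemma horner_alg_inj p q : horner_alg x p = horner_alg x q -> p = q.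
Proof.
by rewrite -!(ev2C x y) => /(dan_ev2_inj dan) /polyC_inj.
Qed.

End StandardDerivation.

Lemma horner_alg_comp (k : fieldType) (A : comAlgType k) (a : A)
    (p q : {poly k}) :
  horner_alg a (p \Po q) = horner_alg (horner_alg a q) p.
Proof.
elim/poly_ind: p => [|p c IH]; first by rewrite comp_poly0 !rmorph0.
rewrite comp_polyD comp_polyM comp_polyX comp_polyC !(rmorphD, rmorphM) /= IH.
by rewrite !horner_algC horner_algX.
Qed.

(** * Isomorphisms *)

Section Transfer.
Variables (k : fieldType) (n1 m1 n2 m2 : nat) (f g : nat -> {poly k}).
Variables (B1 B2 : comAlgType k) (x1 y1 z1 : B1) (x2 y2 z2 : B2).
Hypothesis char0 : [pchar k] =i pred0.
Hypotheses (n1_gt1 : (1 < n1)%N) (m1_gt1 : (1 < m1)%N).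
Hypotheses (n2_gt1 : (1 < n2)%N) (m2_gt1 : (1 < m2)%N).
Hypothesis dan1 : danielewski n1 m1 f x1 y1 z1.
Hypothesis dan2 : danielewski n2 m2 g x2 y2 z2.
Variables (Psi : {lrmorphism B1 -> B2}) (Phi : {lrmorphism B2 -> B1}).
Hypotheses (PsiK : cancel Psi Phi) (PhiK : cancel Phi Psi).

Local Notation xx := ('X%:P : {poly {poly k}}).

Lemma conj_nilpotent (D : {linear B1 -> B1}) :
  (forall b, exists l, iter l D b = 0) ->
  forall b, exists l, iter l (Psi \o D \o Phi) b = 0.
Proof.
move=> nilp b; have [l Dl] := nilp (Phi b); exists l.
suff -> : iter l (Psi \o D \o Phi) b = Psi (iter l D (Phi b)).
  by rewrite Dl rmorph0.
by elim: l {Dl} => [|l IH] /=; rewrite ?PhiK // IH PsiK.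
Qed.

Lemma conj_leibniz (D : {linear B1 -> B1}) :
  (forall a b, D (a * b) = D a * b + a * D b) ->
  forall a b, (Psi \o D \o Phi) (a * b) =
    (Psi \o D \o Phi) a * b + a * (Psi \o D \o Phi) b.
Proof. by move=> leib a b; rewrite /= rmorphM leib rmorphD !rmorphM /= !PhiK. Qed.

(** The standard derivation of B1, conjugated by Psi, is locally nilpotent and so kills x2; thus Phi
    x2 is in the kernel k[x1]. *)
Lemma iso_x2 : exists s, Phi x2 = horner_alg x1 s.
Proof.
have [D [leib _ nilp ker]] := standard_der char0 (ltnW m1_gt1) dan1.
apply: ker; apply: (can_inj PsiK); rewrite rmorph0.
exact: (nilpotent_der_x char0 n2_gt1 m2_gt1 dan2 (D := Psi \o D \o Phi)
  (conj_leibniz leib) (conj_nilpotent nilp)).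
Qed.

(** The conjugated derivation sends Psi y1 to s(x2)^n1 and y2 to x2^n2 h(x2). Hence the numerator of
    Psi y1 has a y-derivative free of y, so it is linear in y, and m2 > 1 allows
    [small_fraction]. *)
Lemma iso_y1 s : Psi x1 = horner_alg x2 s -> s != 0 -> exists u v h,
  Psi y1 = ev2 x2 y2 (u%:P * 'X + v%:P) /\ s ^+ n1 = u * ('X^n2 * h).
Proof.
move=> Psix s0.
have [D [leib Dy nilp ker]] := standard_der char0 (ltnW m1_gt1) dan1.
pose D2 : {linear B2 -> B2} := Psi \o D \o Phi.
have leib2 : forall a b, D2 (a * b) = D2 a * b + a * D2 b by apply: conj_leibniz.
have nilp2 : forall b, exists l, iter l D2 b = 0 by apply: conj_nilpotent.
have D2x := nilpotent_der_x char0 n2_gt1 m2_gt1 dan2 leib2 nilp2.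
have [h D2y] := nilpotent_der_y char0 n2_gt1 m2_gt1 dan2 leib2 nilp2.
have D2Psi : D2 (Psi y1) = ev2 x2 y2 (s ^+ n1)%:P.
  by rewrite /D2 /= PsiK Dy rmorphXn /= Psix ev2C rmorphXn.
have [K [U EU]] := fraction_ex (ltnW m2_gt1) dan2 (Psi y1).
have EU' : ('X^K * s ^+ n1)%:P = U^`() * ('X^n2 * h)%:P.
  apply: (dan_ev2_inj dan2).
  have := congr1 D2 EU; rewrite leib2 (derX leib2) (der_ev2 leib2) D2x D2y D2Psi.
  rewrite !mulr0 mul0rn mul0r !add0r !polyCM !polyC_exp !ev2M => <-.
  by rewrite ev2xX.
have sU' : (size (U^`())%R <= 1)%N.
  have := congr1 (fun V : {poly {poly k}} => size V) EU'.
  rewrite [U^`() * _]mulrC size_polyC mulf_neq0 ?expf_neq0 ?polyX_eq0 //.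
  rewrite size_Cmul => [<- //|].
  apply: contra_eq_neq EU' => ->; rewrite mulr0 polyC_eq0.
  by rewrite mulf_neq0 ?expf_neq0 ?polyX_eq0.
have sU := size_le_deriv char0 sU'.
have [V UV PsiV] := small_fraction (ltnW m2_gt1) dan2 EU (leq_trans sU m2_gt1).
have sV : (size V <= 2)%N by rewrite -(size_xxM K) -UV.
exists V`_1, V`_0, h; rewrite PsiV.
have -> : V = (V`_1)%:P * 'X + (V`_0)%:P.
  apply/polyP => -[|[|i]]; rewrite coefD coefMX !coefC //= ?add0r ?addr0 //.
  by move/leq_sizeP: sV => ->.
rewrite !(coefD, coefMX, coefC) /= add0r addr0; split=> //.
have XK0 : 'X^K != 0 :> {poly k} by rewrite expf_neq0 ?polyX_eq0.
apply: (mulfI XK0); have := congr1 (fun W : {poly {poly k}} => W`_0) EU'.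
rewrite UV -rmorphXn /= coefC /= mul_polyC derivZ coefMC coefZ coef_deriv => ->.
by rewrite mulr1n -mulrA.
Qed.

End Transfer.

(** * The substitutions x -> lambda x, y -> mu y + v(x) *)

Section Substitution.
Variable k : fieldType.
Implicit Types (lambda mu : k) (v : {poly k}) (U : {poly {poly k}}).

Local Notation xx := ('X%:P : {poly {poly k}}).

(* [U(lambda x, mu y + v(x))] *)
Definition bisubst lambda mu v U : {poly {poly k}} :=
  map_poly (comp_poly (lambda *: 'X)) U \Po (mu%:P%:P * 'X + v%:P).

Lemma bisubstD lambda mu v U V :
  bisubst lambda mu v (U + V) = bisubst lambda mu v U + bisubst lambda mu v V.
Proof. by rewrite /bisubst rmorphD comp_polyD. Qed.

Lemma bisubstM lambda mu v U V :
  bisubst lambda mu v (U * V) = bisubst lambda mu v U * bisubst lambda mu v V.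
Proof. by rewrite /bisubst rmorphM comp_polyM. Qed.

Lemma bisubstX lambda mu v : bisubst lambda mu v 'X = mu%:P%:P * 'X + v%:P.
Proof. by rewrite /bisubst map_polyX comp_polyX. Qed.

Lemma bisubstC lambda mu v p :
  bisubst lambda mu v p%:P = (p \Po (lambda *: 'X))%:P.
Proof. by rewrite /bisubst map_polyC comp_polyC. Qed.

Lemma bisubst0 lambda mu v : bisubst lambda mu v 0 = 0.
Proof. by rewrite /bisubst map_poly0 comp_poly0. Qed.

Lemma ev2_bisubst (A : comAlgType k) (a b : A) lambda mu v U :
  ev2 a b (bisubst lambda mu v U) =
  ev2 (lambda *: a) (mu *: b + horner_alg a v) U.
Proof.
elim/poly_ind: U => [|U p IH]; first by rewrite bisubst0 !ev2_0.
rewrite bisubstD bisubstM bisubstX bisubstC !(ev2D, ev2M) IH !ev2X !ev2C.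
by rewrite horner_algC mulr_algl horner_alg_comp linearZ /= horner_algX mulr_algl.
Qed.

(** The two substitutions agree on x and y modulo v - w. For w = 0 and x^n dividing v, congruences
    modulo x^n can be read off with v = 0. *)
Lemma bisubst_sub_dvd lambda mu v w U : exists V,
  bisubst lambda mu v U - bisubst lambda mu w U = (v - w)%:P * V.
Proof.
elim/poly_ind: U => [|U p [V EV]].
  by exists 0; rewrite !bisubst0 subrr mulr0.
exists (V * bisubst lambda mu v 'X + bisubst lambda mu w U).
rewrite !bisubstD !bisubstM !bisubstC mulrDr mulrA -EV.
have -> : (v - w)%:P = bisubst lambda mu v 'X - bisubst lambda mu w 'X.
  by rewrite !bisubstX polyCB; ring.
ring.
Qed.

Lemma coef_bisubst0 lambda mu U i :
  (bisubst lambda mu 0 U)`_i = mu ^+ i *: (U`_i \Po (lambda *: 'X)).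
Proof.
elim/poly_ind: U i => [|U p IH] i.
  by rewrite bisubst0 !coef0 comp_poly0 scaler0.
rewrite bisubstD bisubstM bisubstC bisubstX addr0 !coefD !coefMX !coefC mulrCA.
rewrite coefCM coefMX; case: i => [|i] /=.
  by rewrite mulr0 !add0r scale1r.
by rewrite !addr0 IH mul_polyC scalerA -exprS.
Qed.

Lemma size_linear mu v : (size (mu%:P%:P * 'X + v%:P)%R <= 2)%N.
Proof.
apply: leq_trans (size_polyD _ _) _.
rewrite geq_max (leq_trans (size_polyC_leq1 _)) // mul_polyC.
by rewrite (leq_trans (size_scale_leq _ _)) // size_polyX.
Qed.

Lemma size_bisubst lambda mu v U : (size (bisubst lambda mu v U) <= size U)%N.
Proof.
have [->|U0] := eqVneq U 0; first by rewrite bisubst0 size_poly0.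
apply: leq_trans (size_comp_poly_leq _ _) _.
have sw : ((size (mu%:P%:P * 'X + v%:P)%R).-1 <= 1)%N.
  by rewrite -subn1 leq_subLR size_linear.
have sU : (size (map_poly (comp_poly (lambda *: 'X)) U)%R <= size U)%N.
  exact: size_poly.
have U_gt0 : (0 < size U)%N by rewrite size_poly_gt0.
rewrite -[X in (_ <= X)%N](prednK U_gt0) ltnS -[X in (_ <= X)%N]muln1.
by rewrite leq_mul // -!subn1 leq_sub2r.
Qed.

Lemma coef_linear_exp mu v i :
  ((mu%:P%:P * 'X + v%:P) ^+ i)`_i = (mu ^+ i)%:P /\
  ((mu%:P%:P * 'X + v%:P) ^+ i.+1)`_i = (mu ^+ i *: v) *+ i.+1.
Proof.
have := size_linear mu v; set w := _ + _ => sw.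
have coef_mulw (U : {poly {poly k}}) j : (w * U)`_j.+1 = mu *: U`_j + v * U`_j.+1.
  by rewrite mulrDl coefD coefCM -mulrA coefCM coefXM mul_polyC.
have top j : (w ^+ j)`_j = (mu ^+ j)%:P.
  elim: j => [|j IH]; first by rewrite expr0 coef1.
  rewrite exprS coef_mulw IH [X in v * X](_ : _ = 0) ?mulr0 ?addr0.
    by rewrite exprS polyCM mul_polyC.
  have /leq_sizeP -> // : (size (w ^+ j)%R <= j.+1)%N.
  apply: leq_trans (size_poly_exp_leq _ _) _.
  by rewrite ltnS -[X in (_ <= X)%N]mul1n leq_mul2r -subn1 leq_subLR sw orbT.
split=> //; elim: i => [|i IH].
  by rewrite expr1 coefD coefC coefCM coefX mulr0 add0r expr0 scale1r.
rewrite exprS coef_mulw IH top [v * _]mulrC mul_polyC [RHS]mulrSr -scalerMnr.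
by rewrite scalerA -exprS.
Qed.

(** P has no term in y^(m-1), so only y^m contributes from degree m - 1 on. *)
Lemma bisubst_Pbi lambda mu v m f i : (m.-1 <= i)%N ->
  (bisubst lambda mu v (Pbi m f))`_i = ((mu%:P%:P * 'X + v%:P) ^+ m)`_i.
Proof.
move=> mi; have -> : Pbi m f = 'X^m + (Pbi m f - 'X^m) by rewrite addrC subrK.
rewrite bisubstD coefD [X in _ + X](_ : _ = 0) ?addr0.
  by rewrite /bisubst map_polyXn comp_Xn_poly.
have /leq_sizeP -> // : (size (bisubst lambda mu v (Pbi m f - 'X^m))%R <= m.-1)%N.
apply: leq_trans (size_bisubst _ _ _ _) _; apply/leq_sizeP => j mj.
by rewrite coefB coef_Pbi coefXn ltnNge mj addr0 subrr.
Qed.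

End Substitution.

(** * The shape of an isomorphism *)

Section Isomorphism.
Variables (k : fieldType) (n1 m1 n2 m2 : nat) (f g : nat -> {poly k}).
Variables (B1 B2 : comAlgType k) (x1 y1 z1 : B1) (x2 y2 z2 : B2).
Hypothesis char0 : [pchar k] =i pred0.
Hypotheses (n1_gt1 : (1 < n1)%N) (m1_gt1 : (1 < m1)%N).
Hypotheses (n2_gt1 : (1 < n2)%N) (m2_gt1 : (1 < m2)%N).
Hypothesis dan1 : danielewski n1 m1 f x1 y1 z1.
Hypothesis dan2 : danielewski n2 m2 g x2 y2 z2.
Variables (Psi : {lrmorphism B1 -> B2}) (Phi : {lrmorphism B2 -> B1}).
Hypotheses (PsiK : cancel Psi Phi) (PhiK : cancel Phi Psi).

Local Notation xx := ('X%:P : {poly {poly k}}).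

(** Psi x1 = s(x2) and Phi x2 = r(x1) compose to r(s(x)) = x, so s has degree 1; as x^n2 divides
    s^n1, also s(0) = 0. *)
Lemma iso_xy : exists lambda u v h,
  [/\ lambda != 0, Psi x1 = lambda *: x2,
      Psi y1 = ev2 x2 y2 (u%:P * 'X + v%:P)
    & (lambda ^+ n1)%:P * 'X^n1 = u * ('X^n2 * h)].
Proof.
have [r Phix] := iso_x2 char0 m1_gt1 n2_gt1 m2_gt1 dan1 dan2 PsiK PhiK.
have [s Psix] := iso_x2 char0 m2_gt1 n1_gt1 m1_gt1 dan2 dan1 PhiK PsiK.
have rs : r \Po s = 'X.
  apply: (horner_alg_inj dan2).
  by rewrite horner_alg_comp -Psix -rmorph_horner_alg -Phix PhiK horner_algX.
have ss : size s = 2.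
  have := size_comp_poly r s; rewrite rs size_polyX /= => /esym/eqP.
  by rewrite muln_eq1 => /andP[_]; case: (size s) => [|[|[|?]]].
have s0 : s != 0 by rewrite -size_poly_gt0 ss.
have [u [v [h [Psiy E]]]] :=
  iso_y1 char0 m1_gt1 n2_gt1 m2_gt1 dan1 dan2 PsiK PhiK Psix s0.
have sE : s = (s`_1)%:P * 'X + (s`_0)%:P.
  apply/polyP => -[|[|i]]; rewrite coefD coefMX !coefC //= ?add0r ?addr0 //.
  by rewrite nth_default // ss.
have s00 : s`_0 = 0.
  have /eqP := congr1 (fun p : {poly k} => p.[0]) E.
  rewrite hornerM hornerM hornerXn expr0n (gtn_eqF (ltnW n2_gt1)) mul0r mulr0.
  by rewrite horner_exp expf_eq0 horner_coef0 => /andP[_ /eqP].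
exists s`_1, u, v, h; split=> //.
- by have := s0; rewrite -lead_coef_eq0 lead_coefE ss.
- rewrite Psix {1}sE s00 addr0 rmorphM /= horner_algC horner_algX.
  by rewrite mulr_algl.
- by rewrite -E [in RHS]sE s00 addr0 exprMn polyC_exp.
Qed.

Lemma iso_exponent_le : (n2 <= n1)%N.
Proof.
have [lambda [u [v [h [l0 _ _ E]]]]] := iso_xy.
rewrite leqNgt; apply/negP => lt_n.
have := congr1 (fun p : {poly k} => p`_n1) E.
rewrite coefCM coefXn eqxx mulr1 mulrCA coefXnM lt_n => /eqP.
by rewrite expf_eq0 (negbTE l0) andbF.
Qed.

End Isomorphism.

Section SameExponent.
Variables (k : fieldType) (n m1 m2 : nat) (f g : nat -> {poly k}).
Variables (B1 B2 : comAlgType k) (x1 y1 z1 : B1) (x2 y2 z2 : B2).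
Hypothesis char0 : [pchar k] =i pred0.
Hypotheses (n_gt1 : (1 < n)%N) (m1_gt1 : (1 < m1)%N) (m2_gt1 : (1 < m2)%N).
Hypothesis dan1 : danielewski n m1 f x1 y1 z1.
Hypothesis dan2 : danielewski n m2 g x2 y2 z2.
Variables (Psi : {lrmorphism B1 -> B2}) (Phi : {lrmorphism B2 -> B1}).
Hypotheses (PsiK : cancel Psi Phi) (PhiK : cancel Phi Psi).

Local Notation xx := ('X%:P : {poly {poly k}}).

(** For equal exponents u h = lambda^n, so u is a nonzero constant mu; the last identity is the
    image of x1^n z1 = P1. *)
Lemma iso_xyz : exists lambda mu v,
  [/\ lambda != 0, mu != 0, Psi x1 = lambda *: x2,
      Psi y1 = mu *: y2 + horner_alg x2 v
    & x2 ^+ n * (lambda ^+ n *: Psi z1) =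
      ev2 x2 y2 (bisubst lambda mu v (Pbi m1 f))].
Proof.
have [lambda [u [v [h [l0 Psix Psiy E]]]]] :=
  iso_xy char0 n_gt1 m1_gt1 n_gt1 m2_gt1 dan1 dan2 PsiK PhiK.
have uh : u * h = (lambda ^+ n)%:P.
  have Xn0 : 'X^n != 0 :> {poly k} by rewrite expf_neq0 ?polyX_eq0.
  by apply: (mulIf Xn0); rewrite E mulrAC mulrA.
have ln0 : lambda ^+ n != 0 by rewrite expf_neq0.
have /size_poly1P [mu mu0 Eu] : size u == 1%N.
  have uh0 : u * h != 0 by rewrite uh polyC_eq0.
  have [u0 h0] : u != 0 /\ h != 0.
    by move: uh0; rewrite mulf_eq0 negb_or => /andP[].
  have := congr1 (fun p : {poly k} => size p) uh.
  rewrite size_polyC ln0 size_mul // /=.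
  move: u0 h0; rewrite -!size_poly_gt0.
  by case: (size u) => [|[|a]]; case: (size h) => [|b] //=; rewrite ?addnS.
have {}Psiy : Psi y1 = mu *: y2 + horner_alg x2 v.
  by rewrite Psiy Eu ev2D ev2M ev2X !ev2C horner_algC mulr_algl.
exists lambda, mu, v; split=> //.
rewrite ev2_bisubst -Psix -Psiy -rmorph_ev2 -(dan_rel dan1) rmorphM rmorphXn /=.
by rewrite Psix exprZn -scalerAr -scalerAl.
Qed.

(** If m1 < m2, the numerator P1(lambda x, mu y + v) has y-degree below m2, so x^n divides it,
    against its coefficient mu^m1 at y^m1. *)
Lemma iso_degree_le : (m2 <= m1)%N.
Proof.
have [lambda [mu [v [l0 mu0 _ _ E]]]] := iso_xyz.
rewrite leqNgt; apply/negP => lt_m.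
have sS : (size (bisubst lambda mu v (Pbi m1 f)) <= m2)%N.
  by rewrite (leq_trans (size_bisubst _ _ _ _)) // size_Pbi.
have [V EV _] := small_fraction (ltnW m2_gt1) dan2 E sS.
have := congr1 (fun U : {poly {poly k}} => U`_m1`_0) EV.
rewrite bisubst_Pbi ?leq_pred // (coef_linear_exp _ _ _).1 coefC /=.
rewrite -rmorphXn /= coefCM coefXnM (ltnW n_gt1) => /eqP.
by rewrite expf_eq0 (negbTE mu0) andbF.
Qed.

End SameExponent.

Section SameDegrees.
Variables (k : fieldType) (n m : nat) (f g : nat -> {poly k}).
Variables (B1 B2 : comAlgType k) (x1 y1 z1 : B1) (x2 y2 z2 : B2).
Hypothesis char0 : [pchar k] =i pred0.
Hypotheses (n_gt1 : (1 < n)%N) (m_gt1 : (1 < m)%N).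
Hypothesis dan1 : danielewski n m f x1 y1 z1.
Hypothesis dan2 : danielewski n m g x2 y2 z2.

Local Notation xx := ('X%:P : {poly {poly k}}).

(** In P1(lambda x, mu y + v) - mu^m P2 the terms in y^m cancel, so [small_fraction] makes it a
    multiple of x^n. Its coefficient of y^(m-1) shows that x^n divides v, the lower ones give the
    congruences. *)
Lemma iso_shape (Psi : {lrmorphism B1 -> B2})
    (Phi : {lrmorphism B2 -> B1}) :
  cancel Psi Phi -> cancel Phi Psi ->
  exists lambda mu a V,
  [/\ lambda != 0, mu != 0, coef_cong n m f g lambda mu,
      bisubst lambda mu ('X^n * a) (Pbi m f) - (mu ^+ m)%:P%:P * Pbi m g
      = xx ^+ n * V &
  [/\ Psi x1 = lambda *: x2,
      Psi y1 = mu *: y2 + horner_alg x2 ('X^n * a)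
    & lambda ^+ n *: Psi z1 = mu ^+ m *: z2 + ev2 x2 y2 V]].
Proof.
move=> PsiK PhiK.
have [lambda [mu [v [l0 mu0 Psix Psiy E]]]] :=
  iso_xyz char0 n_gt1 m_gt1 m_gt1 dan1 dan2 PsiK PhiK.
pose W := bisubst lambda mu v (Pbi m f) - (mu ^+ m)%:P%:P * Pbi m g.
have EW : x2 ^+ n * (lambda ^+ n *: Psi z1 - mu ^+ m *: z2) = ev2 x2 y2 W.
  rewrite mulrBr E /W ev2B ev2M -(dan_rel dan2) ev2C horner_algC.
  by rewrite mulr_algl scalerAr.
have Pm h : (Pbi m h)`_m = 1 by rewrite coef_Pbi eqxx ltnNge leq_pred addr0.
have sW : (size W <= m)%N.
  have sW' : (size W <= m.+1)%N.
    apply: leq_trans (size_polyD _ _) _; rewrite geq_max size_polyN.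
    rewrite -[X in (_ <= X)%N && _](size_Pbi m f) size_bisubst mul_polyC.
    by rewrite (leq_trans (size_scale_leq _ _)) // size_Pbi.
  apply/leq_sizeP => j; rewrite leq_eqVlt => /predU1P[<-|]; last first.
    by move/leq_sizeP: sW'; apply.
  rewrite /W coefB coefCM Pm bisubst_Pbi ?leq_pred // (coef_linear_exp _ _ _).1.
  by rewrite mulr1 subrr.
have [V WV PsizE] := small_fraction (ltnW m_gt1) dan2 EW sW.
have coefW j : W`_j = 'X^n * V`_j by rewrite WV -rmorphXn /= coefCM.
(* The coefficient of y^(m-1) in W is m mu^(m-1) v, and m is invertible in characteristic zero. *)
pose c := (mu ^+ m.-1 *+ m)^-1.
have c0 : mu ^+ m.-1 *+ m != 0.
  by rewrite -mulr_natr mulf_neq0 ?expf_neq0 // char0_natr_eq0 // -lt0n ltnW.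
pose a := c *: V`_m.-1.
have va : v = 'X^n * a.
  rewrite /a -scalerAr -coefW /W coefB coefCM bisubst_Pbi //.
  have -> : (Pbi m g)`_m.-1 = 0.
    by rewrite coef_Pbi ltnn addr0; case: eqP => //; move: m_gt1; lia.
  rewrite mulr0 subr0 -{1}[m](prednK (ltnW m_gt1)) (coef_linear_exp _ _ _).2.
  by rewrite (prednK (ltnW m_gt1)) scalerMnl scalerA /c mulVf // scale1r.
exists lambda, mu, a, V; split=> //; last 2 first.
- by rewrite -va.
- by split; rewrite -?va // -PsizE addrC subrK.
move=> i /andP[i2 im].
have j_lt : (m - i < m.-1)%N by move: m_gt1; lia.
have Pj h : (Pbi m h)`_(m - i) = h (m - i)%N.
  by rewrite coef_Pbi j_lt ltn_eqF ?add0r //; move: m_gt1; lia.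
(* Scaling by mu^(m-i) yields the coefficients of y^(m-i) in P1(lambda x, mu y) and mu^m P2. *)
rewrite -(dvdpZr _ _ (expf_neq0 (m - i) mu0)) scalerBr scalerA -exprD subnK //.
have [Q EQ] := bisubst_sub_dvd lambda mu v 0 (Pbi m f).
have := coefW (m - i)%N; rewrite /W coefB coefCM Pj.
have -> : (bisubst lambda mu v (Pbi m f))`_(m - i) =
    mu ^+ (m - i) *: (f (m - i)%N \Po (lambda *: 'X)) + 'X^n * (a * Q`_(m - i)).
  have := congr1 (fun U : {poly {poly k}} => U`_(m - i)) EQ.
  rewrite coefB coef_bisubst0 Pj subr0 coefCM va => /eqP.
  by rewrite subr_eq addrC mulrA => /eqP.
rewrite mul_polyC; move: (mu ^+ (m - i) *: _) (mu ^+ m *: _) => F G FG.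
have -> : F - G = 'X^n * (V`_(m - i) - a * Q`_(m - i)).
  by rewrite mulrBr -FG addrAC addrK.
exact: dvdp_mulIl.
Qed.

Lemma dvd_coefs (W : {poly {poly k}}) : (forall j, 'X^n %| W`_j) ->
  exists V, W = xx ^+ n * V.
Proof.
move=> dW; exists (\poly_(j < size W) (W`_j %/ 'X^n)).
apply/polyP => j; rewrite -rmorphXn /= coefCM coef_poly; case: ltnP => lt_j.
  by rewrite mulrC divpK.
by rewrite mulr0 nth_default.
Qed.

(** The congruences say that P1(lambda x, mu y) - mu^m P2 = x^n V for some V; then (lambda x2, mu
    y2, (mu^m z2 + V) / lambda^n) satisfies the relation of B1. *)
Lemma cong_hom lambda mu : lambda != 0 -> mu != 0 ->
  coef_cong n m f g lambda mu ->
  exists h : {lrmorphism B1 -> B2}, h x1 = lambda *: x2 /\ h y1 = mu *: y2.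
Proof.
move=> l0 mu0 cong.
have [V EV] : exists V, bisubst lambda mu 0 (Pbi m f)
    - (mu ^+ m)%:P%:P * Pbi m g = xx ^+ n * V.
  apply: dvd_coefs => j; rewrite coefB coefCM coef_bisubst0 !coef_Pbi.
  have [->|jm] := eqVneq j m.
    rewrite ltnNge leq_pred !addr0 mulr1 comp_polyC scale_polyC mulr1.
    by rewrite subrr dvdp0.
  rewrite !add0r; case: ltnP => lt_j; last first.
    by rewrite comp_poly0 scaler0 mulr0 subrr dvdp0.
  have ij : (2 <= m - j <= m)%N by lia.
  have jE : (m - (m - j) = j)%N by lia.
  have := cong _ ij; rewrite jE -(dvdpZr _ _ (expf_neq0 j mu0)) scalerBr scalerA.
  by rewrite -exprD subnKC ?mul_polyC //; lia.
have ln0 : lambda ^+ n != 0 by rewrite expf_neq0.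
have rel : (lambda *: x2) ^+ n *
    ((lambda ^+ n)^-1 *: (mu ^+ m *: z2 + ev2 x2 y2 V)) =
    ev2 (lambda *: x2) (mu *: y2) (Pbi m f).
  have := congr1 (ev2 x2 y2) EV; rewrite ev2B ev2_bisubst rmorph0 addr0.
  rewrite !ev2M ev2C horner_algC mulr_algl -(dan_rel dan2) ev2xX => /eqP.
  rewrite subr_eq addrC => /eqP ->.
  by rewrite exprZn -scalerAr -scalerAl scalerA mulVf // scale1r mulrDr scalerAr.
by have [h [hx hy _]] := dan_univ dan1 rel; exists h.
Qed.

End SameDegrees.

(** * Inverses, the converse direction and the final formula *)

Lemma lrmorphism_inverse (k : fieldType) (A B : comAlgType k)
    (h : {lrmorphism A -> B}) : bijective h ->
  exists h' : {lrmorphism B -> A}, cancel h h' /\ cancel h' h.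
Proof.
move=> [h' hK h'K]; have h_inj := can_inj hK.
have h'_zmod : zmod_morphism h'.
  by move=> u v; apply: h_inj; rewrite rmorphB /= !h'K.
have h'_mon : monoid_morphism h'.
  by split=> [|u v]; apply: h_inj; rewrite ?(rmorph1, rmorphM) /= !h'K.
have h'_sc : scalable h'.
  by move=> r u; apply: h_inj; rewrite linearZ /= !h'K.
pose g : {lrmorphism B -> A} := HB.pack h'
  (GRing.isZmodMorphism.Build B A h' h'_zmod)
  (GRing.isMonoidMorphism.Build B A h' h'_mon)
  (GRing.isScalable.Build k B A *:%R h' h'_sc).
by exists g.
Qed.

(** The relation fixes x^n z and x is not a zero divisor, so z is fixed too. *)
Lemma danielewski_endo_id (k : fieldType) (n m : nat) (f : nat -> {poly k})
    (B : comAlgType k) (x y z : B) (h : {lrmorphism B -> B}) : (0 < m)%N ->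
  danielewski n m f x y z -> h x = x -> h y = y -> h =1 id.
Proof.
move=> m_gt0 dan hx hy.
have hz : h z = z.
  apply: (mulxX_inj m_gt0 dan (l := n)).
  have := congr1 h (dan_rel dan).
  by rewrite rmorphM rmorphXn /= rmorph_ev2 hx hy -(dan_rel dan).
move=> b; have [p ->] := dan_gen dan b; rewrite alg_eval_comp.
by congr (alg_eval _ p); apply: val_inj; rewrite /= hx hy hz.
Qed.

(** Substituting x / lambda for x preserves divisibility by x^n, and mu^i is a unit. *)
Lemma coef_cong_sym (k : fieldType) (n m : nat) (f g : nat -> {poly k})
    (lambda mu : k) : lambda != 0 -> mu != 0 -> coef_cong n m f g lambda mu ->
  coef_cong n m g f lambda^-1 mu^-1.
Proof.
move=> l0 mu0 cong i im; have := cong i im; set F := f _; set G := g _.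
move/(dvdp_comp_poly (lambda^-1 *: 'X)).
rewrite comp_Xn_poly exprZn dvdpZl ?expf_neq0 ?invr_eq0 //.
rewrite comp_polyB comp_polyZ -comp_polyA comp_polyZ comp_polyX scalerA.
rewrite mulfV // scale1r comp_polyXr.
rewrite -(dvdpZr _ _ (expf_neq0 i (invr_neq0 mu0))) scalerBr scalerA -exprMn.
by rewrite mulVf // expr1n scale1r -dvdpNr opprB.
Qed.

Lemma Ppoly_ev2 (k : fieldType) (m : nat) (f : nat -> {poly k}) :
  Ppoly m f = ev2 X2 Y2 (Pbi m f).
Proof.
rewrite /Ppoly PbiE ev2D ev2_sum ev2Xn ev2X; congr (_ + _).
by apply: eq_bigr => i _; rewrite ev2M ev2Xn ev2X ev2C.
Qed.

Lemma horner_alg_XnM (k : fieldType) (A : comAlgType k) (b : A) n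
    (p : {poly k}) :
  horner_alg b ('X^n * p) = b ^+ n * horner_alg b p.
Proof. by rewrite rmorphM rmorphXn /= horner_algX. Qed.

Lemma bisubst_quotient (k : fieldType) (n m : nat) (f g : nat -> {poly k})
    (lambda mu : k) (a : {poly k}) (V : {poly {poly k}})
    (A : comAlgType k) (b c : A) :
  lambda != 0 ->
  bisubst lambda mu ('X^n * a) (Pbi m f) - (mu ^+ m)%:P%:P * Pbi m g
    = 'X%:P ^+ n * V ->
  lambda ^+ n *: (b ^+ n * ev2 b c ((lambda ^- n)%:P%:P * V)) =
  ev2 (lambda *: b) (mu *: c + b ^+ n * horner_alg b a) (Pbi m f)
    - mu ^+ m *: ev2 b c (Pbi m g).
Proof.
move=> l0 /(congr1 (ev2 b c)); rewrite ev2B ev2_bisubst !ev2M ev2Xn !ev2C.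
rewrite !horner_algC !mulr_algl horner_algX horner_alg_XnM => ->.
by rewrite -scalerAr scalerA mulfV ?expf_neq0 // scale1r.
Qed.

Lemma alg_eval_ev2 (k : fieldType) (A : comAlgType k) (b c : A)
    (V : {poly {poly k}}) :
  alg_eval [tuple b; c] (ev2 X2 Y2 V) = ev2 b c V.
Proof. by rewrite rmorph_ev2 /= !alg_evalX. Qed.

(** The identity for the quotient V, with lambda^n absorbed, is given in every commutative algebra
    so that it can be used in [{mpoly k[2]}]. *)
Lemma iso_formula (k : fieldType) (n m : nat) (f g : nat -> {poly k})
    (B1 B2 : comAlgType k) (x1 y1 z1 : B1) (x2 y2 z2 : B2)
    (Psi : {lrmorphism B1 -> B2}) (Phi : {lrmorphism B2 -> B1}) :
  [pchar k] =i pred0 -> (1 < n)%N -> (1 < m)%N ->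
  danielewski n m f x1 y1 z1 -> danielewski n m g x2 y2 z2 ->
  cancel Psi Phi -> cancel Phi Psi ->
  exists lambda mu a V,
  [/\ lambda != 0, mu != 0, coef_cong n m f g lambda mu &
  [/\ forall (A : comAlgType k) (b c : A),
        lambda ^+ n *: (b ^+ n * ev2 b c V) =
        ev2 (lambda *: b) (mu *: c + b ^+ n * horner_alg b a) (Pbi m f)
        - mu ^+ m *: ev2 b c (Pbi m g),
      Psi x1 = lambda *: x2,
      Psi y1 = mu *: y2 + x2 ^+ n * horner_alg x2 a
    & Psi z1 = (mu ^+ m / lambda ^+ n) *: z2 + ev2 x2 y2 V]].
Proof.
move=> char0 n_gt1 m_gt1 dan1 dan2 PsiK PhiK.
have [lambda [mu [a [V [l0 mu0 cong EV [Px Py Pz]]]]]] :=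
  iso_shape char0 n_gt1 m_gt1 dan1 dan2 PsiK PhiK.
have ln0 : lambda ^+ n != 0 by rewrite expf_neq0.
exists lambda, mu, a, ((lambda ^- n)%:P%:P * V).
split=> //; split=> //; first by move=> A b c; apply: bisubst_quotient.
  by rewrite Py horner_alg_XnM.
apply: (scalerI ln0); rewrite Pz ev2M ev2C horner_algC mulr_algl.
by rewrite scalerDr !scalerA mulfV // scale1r mulrCA mulfV // mulr1.
Qed.

(** The maps built from (lambda, mu) and from the inverse scalars compose to endomorphisms fixing x
    and y, hence to identities. *)
Lemma cong_iso (k : fieldType) (n m : nat) (f g : nat -> {poly k})
    (B1 B2 : comAlgType k) (x1 y1 z1 : B1) (x2 y2 z2 : B2) (lambda mu : k) :
  (1 < n)%N -> (1 < m)%N ->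
  danielewski n m f x1 y1 z1 -> danielewski n m g x2 y2 z2 ->
  lambda != 0 -> mu != 0 -> coef_cong n m f g lambda mu ->
  exists Psi : {lrmorphism B1 -> B2}, bijective Psi.
Proof.
move=> n_gt1 m_gt1 dan1 dan2 l0 mu0 cong.
have [Psi [Psix Psiy]] := cong_hom n_gt1 m_gt1 dan1 dan2 l0 mu0 cong.
have [Phi [Phix Phiy]] := cong_hom n_gt1 m_gt1 dan2 dan1
  (invr_neq0 l0) (invr_neq0 mu0) (coef_cong_sym l0 mu0 cong).
exists Psi; exists Phi => b.
  apply: (danielewski_endo_id (h := Phi \o Psi) (ltnW m_gt1) dan1).
    by rewrite /= Psix linearZ /= Phix scalerA mulfV // scale1r.
  by rewrite /= Psiy linearZ /= Phiy scalerA mulfV // scale1r.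
apply: (danielewski_endo_id (h := Psi \o Phi) (ltnW m_gt1) dan2).
  by rewrite /= Phix linearZ /= Psix scalerA mulVf // scale1r.
by rewrite /= Phiy linearZ /= Psiy scalerA mulVf // scale1r.
Qed.

Theorem proposition6p6 (k : closedFieldType) (char0 : [pchar k] =i pred0)
    (n1 m1 n2 m2 : nat) (n1_gt1 : (1 < n1)%N) (m1_gt1 : (1 < m1)%N)
    (n2_gt1 : (1 < n2)%N) (m2_gt1 : (1 < m2)%N) (f g : nat -> {poly k}) :
  let P1 : {mpoly k[2]} := Ppoly m1 f in
  let P2 : {mpoly k[2]} := Ppoly m2 g in
  let B1 := Balg n1 P1 in
  let B2 := Balg n2 P2 in
  ((exists Psi : {lrmorphism B1 -> B2}, bijective Psi) <->
     [/\ n1 = n2, m1 = m2 &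
         exists lambda mu : k,
           [/\ lambda != 0, mu != 0 & coef_cong n1 m1 f g lambda mu]]) /\
  (forall Psi : {lrmorphism B1 -> B2}, bijective Psi ->
     exists (lambda mu : k) (a : {poly k}) (q : {mpoly k[2]}),
       [/\ lambda != 0, mu != 0, coef_cong n1 m1 f g lambda mu &
         (* q is the quotient (P1(..) - mu^m P2) / (lambda^n X^n) in k[X,Y] *)
         [/\ lambda ^+ n1 *: (X2 ^+ n1 * q) =
               alg_eval [tuple lambda *: X2;
                               mu *: Y2 + X2 ^+ n1 * horner_alg X2 a] P1
               - mu ^+ m1 *: P2,
             Psi (xB n1 P1) = lambda *: xB n2 P2,
             Psi (yB n1 P1) = mu *: yB n2 P2
               + xB n2 P2 ^+ n1 * horner_alg (xB n2 P2) a &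
             Psi (zB n1 P1) = (mu ^+ m1 / lambda ^+ n1) *: zB n2 P2
               + alg_eval [tuple xB n2 P2; yB n2 P2] q]]).
Proof.
cbv zeta.
have dan1 := Balg_danielewski n1 m1 f.
have dan2 := Balg_danielewski n2 m2 g.
have same_nm
    (Psi : {lrmorphism Balg n1 (Ppoly m1 f) -> Balg n2 (Ppoly m2 g)}) :
  bijective Psi -> n1 = n2 /\ m1 = m2.
  move=> /lrmorphism_inverse[Phi [PsiK PhiK]].
  (* The exponents come first, since [iso_degree_le] needs them equal; each equality uses Psi and
     Phi in turn. *)
  have n_eq : n1 = n2.
    apply/eqP; rewrite eqn_leq.
    apply/andP; split.
      exact: (iso_exponent_le char0 n2_gt1 m2_gt1 n1_gt1 m1_gt1 dan2 dan1 PhiK).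
    exact: (iso_exponent_le char0 n1_gt1 m1_gt1 n2_gt1 m2_gt1 dan1 dan2 PsiK).
  split=> //; subst n2; apply/eqP; rewrite eqn_leq.
  rewrite (iso_degree_le char0 n1_gt1 m1_gt1 m2_gt1 dan1 dan2 PsiK PhiK).
  by rewrite (iso_degree_le char0 n1_gt1 m2_gt1 m1_gt1 dan2 dan1 PhiK PsiK).
split=> [|Psi bij]; first split=> [[Psi bij]|[n_eq m_eq]].
- have [n_eq m_eq] := same_nm _ bij; split; [exact: n_eq|exact: m_eq|].
  have [Phi [PsiK PhiK]] := lrmorphism_inverse bij; subst n2 m2.
  have [lambda [mu [a [V [l0 mu0 cong _]]]]] :=
    iso_formula char0 n1_gt1 m1_gt1 dan1 dan2 PsiK PhiK.
  by exists lambda, mu.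
- move=> [lambda [mu [l0 mu0 cong]]]; subst n2 m2.
  exact: (cong_iso n1_gt1 m1_gt1 dan1 dan2 l0 mu0 cong).
have [n_eq m_eq] := same_nm _ bij.
have [Phi [PsiK PhiK]] := lrmorphism_inverse bij; subst n2 m2.
have [lambda [mu [a [V [l0 mu0 cong [EV Px Py Pz]]]]]] :=
  iso_formula char0 n1_gt1 m1_gt1 dan1 dan2 PsiK PhiK.
(* The quotient is moved from k[x][y] to [{mpoly k[2]}], where [EV] becomes the required
   identity. *)
exists lambda, mu, a, (ev2 X2 Y2 V).
split; [exact: l0|exact: mu0|exact: cong|split; [|exact: Px|exact: Py|]].
  by rewrite EV alg_eval_Ppoly -Ppoly_ev2.
exact: etrans Pz (congr1 _ (esym (alg_eval_ev2 _ _ _))).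
Qed.
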